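(* Let $p(n)$ be the partition function (with $p(n)=0$ for $n<0$), let $\sigma_m(n)=\sum_{d\mid n}d^m$, and for $m\ge0$, $n\ge0$ let \[ M_m(n)=\sum_{k\ge1}k^mF_k(n)=\sum_{d=1}^{n}\sigma_m(d)\,p(n-d), \] where $F_k(n)$ is the total number of parts equal to $k$ among all partitions of $n$. Then: (i) For every odd $m$ and every prime $\ell\ge5$ there is an odd $\overline m\in\{1,3,\dots,\ell-2\}$ with $\overline m\equiv m\pmod{\ell-1}$ such that $M_m(n)\equiv M_{\overline m}(n)\pmod{\ell}$ for all $n\ge0$. (ii) For every prime $\ell\ge5$ and every odd $m\equiv1\pmod{\ell-1}$, $M_m(\ell n)\equiv0\pmod{\ell}$ for all $n\ge0$; in particular $M_1(\ell n)=\ell n\,p(\ell n)\equiv0\pmod\ell$. (iii) For odd $m$: if $m\equiv1\pmod4$ then $M_m(5n+4)\equiv0\pmod5$; if $m\equiv1\pmod6$ then $M_m(7n+5)\equiv0\pmod7$; if $m\equiv1\pmod{10}$ then $M_m(11n+6)\equiv0\pmod{11}$; all for every $n\ge0$. (iv) For all $n\ge0$: \[ M_3(7n)\equiv0\pmod7,\quad M_3(7n+5)\equiv0\pmod7,\quad M_3(11n)\equiv0\pmod{11},\quad M_3(11n+6)\equiv0\pmod{11},\quad M_7(11n+6)\equiv0\pmod{11}. \] (v) For every odd $m$ with $1\le m\le25$, every prime $5\le\ell\le97$ and every residue $1\le r<\ell$: if $M_m(\ell n+r)\equiv0\pmod\ell$ for all $n\ge0$, then $\ell\in\{5,7,11\}$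 and the congruence is a Fermat lift (in the sense of (i)) of one of the base congruences for $M_1$, $M_3$, $M_7$ given in (iii) and (iv), i.e. $(\ell,r)\in\{(5,4),(7,5),(11,6)\}$ and $M_{\overline m}(\ell n+r)\equiv0\pmod{\ell}$ is one of the congruences listed in (iii)–(iv) with $\overline m\in\{1,3,7\}$, $\overline m\equiv m\pmod{\ell-1}$.
   Context: $F_k(n)$ denotes the total number of occurrences of the part $k$ across all partitions of $n$; the identity $\sum_k k^mF_k(n)=\sum_{d=1}^n\sigma_m(d)p(n-d)$ holds and may be taken as the definition of $M_m(n)$. *)

(* Defs.v *)
From mathcomp Require Import all_boot.

Set Implicit Arguments.
Unset Strict Implicit.
Unset Printing Implicit Defensive.

Definition is_partition (n : nat) (s : seq nat) : bool :=
  [&& sorted geq s, 0 \notin s & sumn s == n].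

(* A partition of n has at most n parts, each at most n, so every partition of
   n occurs among the bounded sequences of size at most n over 'I_n.+1. *)
Definition partitions (n : nat) : {set n.-bseq 'I_n.+1} :=
  [set s : n.-bseq 'I_n.+1 | is_partition n (map val s)].

Definition p (n : nat) : nat := #|partitions n|.

Definition F (k n : nat) : nat :=
  \sum_(s in partitions n) count_mem k (map val s).

Definition sigma (m n : nat) : nat := \sum_(d <- divisors n) d ^ m.

(* The sum over all k >= 1 stops at n since F k n = 0 for k > n. *)
Definition M (m n : nat) : nat := \sum_(1 <= k < n.+1) k ^ m * F k n.

Definition fermat_lift (l m mb : nat) : Prop :=
  [/\ odd mb, 1 <= mb <= l - 2, mb = m %[mod l - 1]
    & forall n, M m n = M mb n %[mod l]].

(* Triples (mb, l, r) standing for M_mb(l n + r) = 0 mod l. *)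
Definition base_congruences : seq (nat * nat * nat) :=
  [:: (1, 5, 4); (1, 7, 5); (1, 11, 6);
      (3, 7, 0); (3, 7, 5); (3, 11, 0); (3, 11, 6); (7, 11, 6)].

(* Main.v *)
Require Import Defs.
From mathcomp Require Import all_boot.
From mathcomp Require Import all_order all_algebra qpoly zify ring.
From Stdlib Require BinNat Nnat.

(** With [E = prod_n (1 - q^n)], [P = 1 / E] and [S_m = sum_n sigma_m(n) q^n] the
    generating function of [M_m] is [S_m P].

    Divided by [1 - z], Jacobi's triple product has the logarithmic [z]-derivative
    [z d/dz log = sum_n q^n sum_{d | n} (z^-d - z^d)].
    Taking [z d/dz]-moments at [z = 1] expresses [t_0^k S_m], [k = (m + 1) / 2],
    as a polynomial in the moments [t_i = sum_n (-1)^n q^(n(n+1)/2)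
    sum_{|a| <= n} a^i], where [t_0 = E^3 =: J]. Modulo a small prime [l], every
    even [t_i] is a combination of the parts [J_r] of [J] supported on exponents
    congruent to [r], and few residues [r] occur. Since [P = J^a (P^l)^b] with
    [3 a + 1 = b l] and [P^l] is a series in [q^l], a congruence
    [M_m(l n + r) = 0] says that the residue [r] part of a form of degree [a] in
    the [J_r] vanishes. For [l = 5, 7] no monomial has that residue (or its
    coefficient is zero). For [l = 11] the identity [J^4 = E * E^11] and Euler's
    pentagonal theorem give five quartic relations between the [J_r], and the
    forms in question lie in the ideal that they generate.

    Fermat's little theorem reduces the exponent [m] modulo [l - 1], and the
    absence of further congruences is a finite computation: [n <= 2] always
    suffices to refute one. *)

Set Implicit Arguments.
Unset Strict Implicit.
Unset Printing Implicit Defensive.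
Import GRing.Theory.

(** * Partitions *)

(** Plain lists of naturals, freed from the bounded types, so that parts can be added and removed
    without tracking the bound [n]. *)
Definition plist (n : nat) : seq (seq nat) :=
  [seq [seq val i | i <- val s] | s <- enum (partitions n)].

Lemma size_le_sumn (s : seq nat) : 0 \notin s -> size s <= sumn s.
Proof.
elim: s => [//|a s IH]; rewrite inE negb_or eq_sym => /andP[a0 /IH]/=.
by case: a a0 => // a _; lia.
Qed.

Lemma mem_le_sumn (s : seq nat) a : a \in s -> a <= sumn s.
Proof.
by elim: s => [//|b s IH]; rewrite inE => /orP[/eqP->|/IH] /=; lia.
Qed.

Lemma plist_uniq n : uniq (plist n).
Proof.
rewrite map_inj_uniq ?enum_uniq // => s t /inj_map h.
by apply: val_inj; apply: h; exact: val_inj.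
Qed.

Lemma mem_plist n s : (s \in plist n) = is_partition n s.
Proof.
apply/mapP/idP => [[t + ->]|sP]; first by rewrite mem_enum inE.
have [ss s0 /eqP sn] := and3P sP.
have le_n : size s <= n by rewrite -sn size_le_sumn.
have lt a : a \in s -> a < n.+1 by rewrite ltnS -sn; apply: mem_le_sumn.
pose t := [seq inord i : 'I_n.+1 | i <- s].
have st : size t <= n by rewrite size_map.
have tE : [seq val i | i <- t] = s.
  rewrite -map_comp -[RHS]map_id; apply/eq_in_map => a /lt /=.
  by move/inordK->.
by exists (Bseq st); rewrite ?mem_enum ?inE /= tE.
Qed.

Lemma pE n : p n = size (plist n).
Proof. by rewrite /p cardE size_map. Qed.

Lemma FE k n : F k n = \sum_(s <- plist n) count_mem k s.
Proof. by rewrite /F big_map -big_enum. Qed.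

Definition insert_part (k : nat) (s : seq nat) : seq nat := sort geq (k :: s).

Lemma geq_total : total geq.
Proof. by move=> a b; rewrite /geq /=; case: leqP => //= /ltnW. Qed.
Lemma geq_trans : transitive geq.
Proof. by move=> b a c /= ab bc; apply: leq_trans bc ab. Qed.
Lemma geq_antisym : antisymmetric geq.
Proof. by move=> a b /= /andP[ab ba]; apply/eqP; rewrite eqn_leq ab ba. Qed.

Lemma perm_insert_part k s : perm_eq (insert_part k s) (k :: s).
Proof. by rewrite perm_sort. Qed.

Lemma insert_part_inj n k :
  {in plist n &, injective (insert_part k)}.
Proof.
move=> s t; rewrite !mem_plist => /and3P[ss _ _] /and3P[st _ _] e.
apply: (sorted_eq geq_trans geq_antisym ss st).
rewrite -(perm_cons k) -(permPl (perm_insert_part k s)) e.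
exact: perm_insert_part.
Qed.

(** Removing one copy of [k] inverts [insert_part k], because a sorted list is determined by its
    multiset of entries. *)
Lemma perm_plist_insert n k : 0 < k <= n ->
  perm_eq [seq s <- plist n | k \in s] [seq insert_part k s | s <- plist (n - k)].
Proof.
move=> /andP[k0 kn]; apply: uniq_perm.
- exact/filter_uniq/plist_uniq.
- by rewrite map_inj_in_uniq ?plist_uniq //; exact: insert_part_inj.
move=> s; rewrite mem_filter mem_plist; apply/andP/mapP.
- move=> [ks /and3P[ss s0 /eqP sn]]; exists (rem k s).
    rewrite mem_plist; apply/and3P; split.
    + exact: subseq_sorted geq_trans _ _ (rem_subseq k s) ss.
    + by apply: contra s0; apply: mem_rem.
    + by have := perm_sumn (perm_to_rem ks); rewrite /= sn => ->; rewrite addKn.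
  apply: (sorted_eq geq_trans geq_antisym ss).
    exact: sort_sorted geq_total _.
  by rewrite perm_sym (permPl (perm_insert_part _ _)) perm_sym perm_to_rem.
- move=> [t]; rewrite mem_plist => /and3P[ts t0 /eqP tn] ->.
  have pt := perm_insert_part k t; split; first by rewrite (perm_mem pt) mem_head.
  apply/and3P; split.
  + exact: sort_sorted geq_total _.
  + by rewrite (perm_mem pt) inE negb_or t0 andbT neq_ltn k0.
  + by rewrite (perm_sumn pt) /= tn subnKC.
Qed.

Lemma sum_plist_insert n k (f : seq nat -> nat) : 0 < k <= n ->
  \sum_(s <- plist n | k \in s) f s =
  \sum_(s <- plist (n - k)) f (insert_part k s).
Proof.
move=> kn; rewrite -big_filter (perm_big _ (perm_plist_insert kn)) /=.
by rewrite big_map.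
Qed.

Lemma F_small k n : n < k -> F k n = 0.
Proof.
move=> nk; rewrite FE big_seq big1 // => s; rewrite mem_plist.
move=> /and3P[_ _ /eqP sn]; apply/count_memPn.
by apply: contraL nk => /mem_le_sumn; rewrite sn -leqNgt.
Qed.

Lemma F_rec k n : 0 < k <= n -> F k n = p (n - k) + F k (n - k).
Proof.
move=> kn; rewrite FE (bigID (fun s => k \in s)) /= [X in _ + X]big1 => [|s].
  rewrite addn0 sum_plist_insert // FE pE -sum1_size -big_split /=.
  by apply: eq_bigr => s _; rewrite (permP (perm_insert_part k s)) /= eqxx.
by move/count_memPn.
Qed.

(** Iteration of [F_rec]; the term [j] counts the partitions in which [k] occurs at least [j]
    times. *)
Lemma F_sum k n : 0 < k -> F k n = \sum_(1 <= j < n.+1 | j * k <= n) p (n - j * k).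
Proof.
move=> k0; elim/ltn_ind: n => n IH.
have [nk|kn] := ltnP n k.
  rewrite F_small // big_nat_cond big1 // => j /andP[/andP[j1 _] jn]; nia.
rewrite F_rec ?k0 // IH; last by lia.
rewrite [RHS]big_ltn_cond; last by lia.
rewrite mul1n kn; congr (_ + _); rewrite [RHS]big_add1 /=.
rewrite [RHS](@big_cat_nat _ _ _ (n - k).+1) /=; [|lia..].
rewrite [X in _ = _ + X]big_nat_cond [X in _ = _ + X]big1 ?addn0; last first.
  by move=> j; rewrite mulSn => /andP[/andP[h1 h2] h3]; nia.
apply: eq_big => [j|j _]; rewrite mulSn; first by lia.
by congr p; lia.
Qed.

(** The pairs [(k, j)] coming from [F_sum] are regrouped by the product [d = j * k], so that [k]
    runs over the divisors of [d]. *)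
Lemma M_sigma m n : M m n = \sum_(1 <= d < n.+1) sigma m d * p (n - d).
Proof.
transitivity (\sum_(1 <= k < n.+1) \sum_(1 <= d < n.+1 | k %| d) k ^ m * p (n - d)).
  rewrite /M [LHS]big_nat_cond [RHS]big_nat_cond.
  apply: eq_bigr => k /andP[/andP[k0 kn] _].
  rewrite F_sum // big_distrr /=.
  rewrite -[RHS]big_filter -[LHS]big_filter.
  set r := [seq _ <- _ | _ <= n].
  rewrite -(big_map (fun j => j * k) xpredT (fun d => k ^ m * p (n - d))).
  apply: perm_big; apply: uniq_perm.
  - rewrite map_inj_uniq ?filter_uniq ?iota_uniq // => a b /eqP.
    by rewrite eqn_pmul2r // => /eqP.
  - by rewrite filter_uniq ?iota_uniq.
  move=> d; rewrite mem_filter mem_index_iota; apply/mapP/andP.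
  - move=> [j]; rewrite mem_filter mem_index_iota => /and3P[h1 h2 h3] ->.
    by rewrite dvdn_mull //; split=> //; nia.
  - move=> [/dvdnP[j ->] h]; exists j => //.
    by rewrite mem_filter mem_index_iota; nia.
rewrite (exchange_big_dep_nat predT) //= big_nat_cond [RHS]big_nat_cond.
apply: eq_bigr => d /andP[/andP[d0 dn] _].
rewrite -big_distrl /=; congr (_ * _).
rewrite /sigma -big_filter; apply: perm_big; apply: uniq_perm.
- by rewrite filter_uniq ?iota_uniq.
- exact: divisors_uniq.
move=> k; rewrite mem_filter mem_index_iota -dvdn_divisors //.
apply: andb_idr => kd; rewrite (dvdn_gt0 d0 kd) /=.
by apply: leq_ltn_trans (dvdn_leq d0 kd) dn.
Qed.

Lemma sumn_count (n : nat) (s : seq nat) : all (fun i => i <= n) s ->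
  sumn s = \sum_(1 <= k < n.+1) k * count_mem k s.
Proof.
elim: s => [_|a s IH] /=; first by rewrite big1 // => k _; rewrite muln0.
move=> /andP[an /IH->].
under [RHS]eq_bigr do rewrite mulnDr.
rewrite big_split /=; congr (_ + _).
have [->|a0] := posnP a.
  by rewrite big_nat big1 // => k /andP[k0 _]; case: k k0 => //= k _; rewrite muln0.
rewrite (bigD1_seq a) ?iota_uniq ?mem_index_iota ?a0 //= eqxx muln1.
by rewrite big1 ?addn0 // => k ka; rewrite eq_sym (negPf ka) muln0.
Qed.

(** Double counting: the parts of each partition of [n] sum to [n]. *)
Lemma M1 n : M 1 n = n * p n.
Proof.
rewrite /M; under eq_bigr do rewrite expn1 FE big_distrr /=.
rewrite exchange_big /= pE -sum1_size big_distrr /= big_seq [RHS]big_seq.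
apply: eq_bigr => s; rewrite mem_plist => /and3P[_ _ /eqP sn].
rewrite -sumn_count ?muln1 //; apply/allP => a /mem_le_sumn.
by rewrite sn.
Qed.

(** Bounding the parts by [k] gives generating functions inverse to the finite products [qpoch k],
    hence an induction on [k] that leads to [p]. *)
Definition pk (k n : nat) : nat := count (all (fun i => i <= k)) (plist n).

Lemma pk_p k n : n <= k -> pk k n = p n.
Proof.
move=> nk; rewrite pE; apply/eqP; rewrite -all_count; apply/allP => s.
rewrite mem_plist => /and3P[_ _ /eqP sn]; apply/allP => a /mem_le_sumn.
by rewrite sn => /leq_trans; apply.
Qed.

Lemma pk0 n : pk 0 n = (n == 0).
Proof.
rewrite /pk; have [->|n0] := posnP n.
  rewrite -/(pk 0 0) pk_p // pE.
  have -> : plist 0 = [:: [::]]; last by [].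
  apply: perm_small_eq => //; apply: uniq_perm => //; first exact: plist_uniq.
  move=> s; rewrite mem_plist inE; apply/idP/eqP => [|->] //.
  case/and3P => _ s0 /eqP sn.
  by apply/nilP; rewrite /nilp -leqn0 -sn size_le_sumn.
rewrite (@eq_in_count _ _ pred0) ?count_pred0 // => s.
rewrite mem_plist => /and3P[_ s0 /eqP sn] /=.
case: s s0 sn => [_ /= sn|a s]; first by move: n0; rewrite -sn.
by rewrite inE negb_or; case: a.
Qed.

Lemma pk_rec k n :
  pk k.+1 n = pk k n + (if k < n then pk k.+1 (n - k.+1) else 0).
Proof.
rewrite /pk -!sum1_count (bigID (fun s => k.+1 \in s)) /= addnC; congr (_ + _).
  apply: eq_bigl => s; apply/andP/allP => [[/allP h ks] a sa|h].
    have := h _ sa; rewrite leq_eqVlt ltnS => /orP[/eqP e|//].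
    by rewrite -e sa in ks.
  split; first by apply/allP => a /h /leqW.
  by apply/negP => /h; rewrite ltnn.
case: ltnP => kn; last first.
  rewrite big_seq_cond big1 // => s; rewrite mem_plist.
  by move=> /and3P[/and3P[_ _ /eqP sn] _ /mem_le_sumn]; rewrite sn ltnNge kn.
rewrite big_mkcondl sum_plist_insert // -big_mkcond /=.
by apply: eq_bigl => s; rewrite (perm_all _ (perm_insert_part _ _)) /= leqnn.
Qed.

(** * Jacobi's triple product *)

Section QBinomial.
Local Open Scope ring_scope.
Variables (R : comNzRingType) (q : R).

(** Gaussian binomial coefficients, given by a q-Pascal rule because the quotient of products would
    need inverses in [R]. *)
Fixpoint qbin (n k : nat) {struct n} : R :=
  match n, k with
  | _, 0 => 1
  | 0, _.+1 => 0
  | n'.+1, k'.+1 => qbin n' k' + q ^+ k * qbin n' k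
  end.

Definition qpoch (m : nat) : R := \prod_(i < m) (1 - q ^+ i.+1).

Lemma qbin0 n : qbin n 0 = 1. Proof. by case: n. Qed.

Lemma qbinS n k : qbin n.+1 k.+1 = qbin n k + q ^+ k.+1 * qbin n k.+1.
Proof. by []. Qed.

Lemma qbin_small n k : (n < k)%N -> qbin n k = 0.
Proof.
elim: n k => [|n IH] [|k] //= nk.
by rewrite !IH ?mulr0 ?addr0 //; lia.
Qed.

Lemma qbinn n : qbin n n = 1.
Proof. by elim: n => // n IH; rewrite qbinS IH qbin_small ?mulr0 ?addr0. Qed.

(** The q-Pascal rule with the power of [q] on the other term; the step on [b] in
    [finite_triple_product] needs this form. *)
Lemma qbinS_dual n k : (k <= n)%N ->
  qbin n.+1 k.+1 = q ^+ (n - k) * qbin n k + qbin n k.+1.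
Proof.
elim: n k => [|n IH] k kn.
  by case: k kn => // _; rewrite /= !mulr0 mulr1 !addr0.
case: k kn => [_|k kn].
  rewrite (qbinS n.+1 0) {1}IH // (qbinS n 0) !qbin0 !subn0.
  by rewrite !exprS; ring.
have [kn'|nk] := ltnP k.+1 n.+1.
  rewrite [LHS]qbinS [in LHS](IH k) 1?[in LHS](IH k.+1) //; try lia.
  rewrite (qbinS n k) (qbinS n k.+1).
  have -> : (n.+1 - k.+1 = (n - k.+1).+1)%N by lia.
  have -> : (n - k = (n - k.+1).+1)%N by lia.
  by rewrite !exprS; ring.
have -> : k = n by lia.
by rewrite subnn !qbinn qbin_small // mulr1 addr0.
Qed.

Lemma qpochS m : qpoch m.+1 = qpoch m * (1 - q ^+ m.+1).
Proof. by rewrite /qpoch big_ord_recr. Qed.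

Lemma qbin_qpoch n k : (k <= n)%N ->
  qbin n k * qpoch k * qpoch (n - k) = qpoch n.
Proof.
elim: n k => [|n IH] k kn.
  by case: k kn => // _; rewrite /qpoch big_ord0 !mulr1.
case: k kn => [_|k kn]; first by rewrite qbin0 /qpoch big_ord0 subn0 !mul1r.
have [kn'|nk] := ltnP k n; last first.
  have -> : k = n by lia.
  by rewrite qbinn subnn [qpoch 0]/qpoch big_ord0 mul1r mulr1.
rewrite qbinS subSS qpochS.
have e1 := IH k kn; have e2 := IH k.+1 kn'.
have e3 : qpoch (n - k) = qpoch (n - k.+1) * (1 - q ^+ (n - k)).
  have -> : (n - k = (n - k.+1).+1)%N by lia.
  by rewrite -qpochS.
rewrite qpochS in e2.
have e4 : q ^+ n.+1 = q ^+ k.+1 * q ^+ (n - k) by rewrite -exprD; congr (_ ^+ _); lia.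
rewrite qpochS e4 mulrDl mulrDl.
have -> : qbin n k * (qpoch k * (1 - q ^+ k.+1)) * qpoch (n - k)
   = qpoch n * (1 - q ^+ k.+1) by rewrite -e1; ring.
rewrite e3.
have -> : q ^+ k.+1 * qbin n k.+1 * (qpoch k * (1 - q ^+ k.+1))
     * (qpoch (n - k.+1) * (1 - q ^+ (n - k)))
   = q ^+ k.+1 * (1 - q ^+ (n - k)) * qpoch n by rewrite -e2; ring.
by ring.
Qed.

(* [w] homogenizes the classical specialisation [x = z], [y = q / z], so that
   no inverse of [z] is needed. *)
Variables x y w : R.
Hypothesis xy : x * y = q * w.

(** Both branches are [w^a x^(k-a) q^C(k-a, 2)] with an integer [k - a]; a negative power of [x] is
    traded for [y] through [xy]. *)
Definition theta_term (a k : nat) : R :=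
  if (k <= a)%N then y ^+ (a - k) * q ^+ 'C(a - k, 2) * w ^+ k
  else x ^+ (k - a) * q ^+ 'C(k - a, 2) * w ^+ a.

Lemma theta_term_step a b k : (k <= a + b)%N ->
  x * q ^+ b * theta_term a k = q ^+ (a + b - k) * theta_term a k.+1.
Proof.
move=> kab; rewrite /theta_term; have [ka|ka] := ltnP k a.
  rewrite (ltnW ka).
  have -> : (a - k = (a - k.+1).+1)%N by lia.
  have -> : (a + b - k = b + (a - k.+1) + 1)%N by lia.
  rewrite binS bin1 !exprD !exprS.
  set u := y ^+ _; set v := q ^+ 'C(_, _); set t := q ^+ (_ - _).
  transitivity (u * v * t * w ^+ k * q ^+ b * (x * y)); first by ring.
  by rewrite xy; ring.
have [ak|ak] := leqP k a.
  have -> : k = a by lia.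
  have -> : (a + b - a = b)%N by lia.
  by rewrite subnn subSn // subnn /= !expr0; ring.
have -> : (k.+1 - a = (k - a).+1)%N by lia.
rewrite binS bin1 exprD exprS.
have -> : b = ((a + b - k) + (k - a))%N by lia.
have -> : (a + (a + b - k + (k - a)) - k = a + b - k)%N by lia.
by rewrite exprD; ring.
Qed.

Lemma theta_termSS a k : theta_term a.+1 k.+1 = theta_term a k * w.
Proof. by rewrite /theta_term ltnS !subSS; case: leqP => _; rewrite !exprS; ring. Qed.

Lemma theta_termSl a k : (k <= a)%N ->
  q ^+ k * theta_term a.+1 k = y * q ^+ a * theta_term a k.
Proof.
move=> ka; rewrite /theta_term ka leqW // subSn // binS bin1.
have -> : q ^+ a = q ^+ k * q ^+ (a - k) by rewrite -exprD subnKC.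
by rewrite exprS exprD; ring.
Qed.

Lemma finite_triple_product_left a :
  \prod_(j < a) (w - y * q ^+ j) =
  \sum_(k < a.+1) (-1) ^+ (a + k) * qbin a k * theta_term a k.
Proof.
elim: a => [|a IH].
  by rewrite big_ord0 big_ord1 /= /theta_term /= !expr0 !mul1r.
rewrite big_ord_recr /= IH [RHS]big_ord_recl /=.
pose u (k : nat) := (-1) ^+ (a.+1 + k) * (q ^+ k * qbin a k) * theta_term a.+1 k.
rewrite [X in _ = _ + X](eq_bigr (fun k : 'I_a.+1 =>
   (-1) ^+ (a + k) * qbin a k * theta_term a k * w + u k.+1)); last first.
  move=> k _; rewrite /u /bump /= !add0n add1n theta_termSS addnS addSn !exprS.
  by ring.
rewrite big_split /= -mulr_suml addrCA mulrBr; congr (_ + _).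
transitivity (\sum_(k < a.+2) u k); last first.
  rewrite big_ord_recl /=; congr (_ + _).
  by rewrite /u qbin0 expr0; ring.
rewrite [RHS]big_ord_recr /= [X in _ = _ + X]/u qbin_small // !(mulr0, mul0r) addr0.
rewrite mulr_suml -sumrN; apply: eq_bigr => k _.
have ka : (k <= a)%N by have := ltn_ord k; lia.
transitivity (- ((-1) ^+ (a + k) * qbin a k * (y * q ^+ a * theta_term a k))).
  by ring.
by rewrite -theta_termSl // /u addSn exprS; ring.
Qed.

(** Induction on [b]: the new factor shifts the theta terms by [theta_term_step], and [qbinS_dual]
    recombines the two sums. *)
Lemma finite_triple_product a b :
  \prod_(j < a) (w - y * q ^+ j) * \prod_(j < b) (1 - x * q ^+ j) =
  \sum_(k < (a + b).+1) (-1) ^+ (a + k) * qbin (a + b) k * theta_term a k.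
Proof.
elim: b => [|b IH].
  by rewrite big_ord0 mulr1 addn0 finite_triple_product_left.
rewrite big_ord_recr /= mulrA IH addnS [RHS]big_ord_recl /=.
set n := (a + b)%N.
pose u (k : nat) := (-1) ^+ (a + k) * qbin n k * theta_term a k.
rewrite [X in _ = _ + X](eq_bigr (fun k : 'I_n.+1 =>
   - (x * q ^+ b) * u k + u k.+1)); last first.
  move=> k _; rewrite /u /bump /= add1n -/(qbin n.+1 k.+1).
  have kn : (k <= n)%N by have := ltn_ord k; lia.
  rewrite qbinS_dual // addnS exprS.
  transitivity (- ((-1) ^+ (a + k) * qbin n k * (q ^+ (n - k) * theta_term a k.+1))
     - (-1) ^+ (a + k) * qbin n k.+1 * theta_term a k.+1); first by ring.
  by rewrite -theta_term_step //; ring.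
rewrite big_split /= -mulr_sumr addrCA mulrBr mulr1 [LHS]addrC mulNr.
rewrite [X in - X + _ = _]mulrC; congr (_ + _).
transitivity (\sum_(k < n.+2) u k); last first.
  by rewrite big_ord_recl /= /u qbin0.
by rewrite [RHS]big_ord_recr /= [X in _ = _ + X]/u qbin_small // !(mulr0, mul0r) addr0.
Qed.

End QBinomial.

(** * The triple product for a nilpotent [q] *)

Section Nilpotent.
Local Open Scope ring_scope.
Variables (R : comNzRingType) (q : R) (N : nat).
Hypothesis qN : q ^+ N = 0.

Lemma expr_nil i : (N <= i)%N -> q ^+ i = 0.
Proof. by move=> Ni; rewrite -(subnKC Ni) exprD qN mul0r. Qed.

Lemma qpoch_nil m : (N <= m)%N -> qpoch q m = qpoch q N.
Proof.
move=> Nm; rewrite -(subnKC Nm); elim: (m - N)%N => [|d IH]; first by rewrite addn0.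
by rewrite addnS qpochS IH expr_nil ?subr0 ?mulr1 //; lia.
Qed.

Lemma qpoch_inv m : exists v, v * qpoch q m = 1.
Proof.
elim: m => [|m [v IH]]; first by exists 1; rewrite /qpoch big_ord0 mulr1.
have g : (\sum_(i < N) (q ^+ m.+1) ^+ i) * (1 - q ^+ m.+1) = 1.
  rewrite mulrC -opprB mulNr -subrX1 -exprM expr_nil ?sub0r ?opprK //.
  by rewrite mulSn leq_addr.
exists (v * \sum_(i < N) (q ^+ m.+1) ^+ i).
rewrite qpochS -{}[RHS]g -[in RHS](mul1r (\sum_(i < N) _)) -IH.
by ring.
Qed.

(** All three products in [qbin_qpoch] equal [qpoch q N], and one copy cancels by [qpoch_inv]. *)
Lemma qbin_nil n k : (N <= k)%N -> (k + N <= n)%N -> qpoch q N * qbin q n k = 1.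
Proof.
move=> Nk kn; have kn' : (k <= n)%N by lia.
have := qbin_qpoch q kn'; rewrite !qpoch_nil; try lia.
have [v vE] := qpoch_inv N => e.
rewrite -[LHS]mul1r -{1}vE.
transitivity (v * (qbin q n k * qpoch q N * qpoch q N)); first by ring.
by rewrite e.
Qed.

Lemma theta_term_nil x y w m k : (N + k < m)%N || (N + m < k)%N ->
  theta_term q x y w m k = 0.
Proof.
have h d : (N < d)%N -> q ^+ 'C(d, 2) = 0.
  by case: d => // d Nd; rewrite expr_nil // binS bin1; lia.
by rewrite /theta_term; case: (leqP k m) => km hN; rewrite h ?mulr0 ?mul0r //; lia.
Qed.

(** Theta terms further than [N] from the centre [m] vanish. For the others [m = 2 N] leaves enough
    room on both sides to apply [qbin_nil]. *)
Lemma triple_product x y w : x * y = q * w -> let m := N.*2 in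
  qpoch q N * (\prod_(j < m) (w - y * q ^+ j) * \prod_(j < m) (1 - x * q ^+ j)) =
  \sum_(k < (m + m).+1) (-1) ^+ (m + k) * theta_term q x y w m k.
Proof.
move=> xy m; rewrite finite_triple_product // mulr_sumr; apply: eq_bigr => k _.
have := ltn_ord k; rewrite ltnS => km.
have [h|h] := boolP ((N + k < m)%N || (N + m < k)%N).
  by rewrite theta_term_nil // !mulr0.
rewrite -[in RHS](mulr1 ((-1) ^+ _)) -(@qbin_nil (m + m) k); [by ring| |].
  by rewrite /m in h *; lia.
by rewrite /m in h *; lia.
Qed.

End Nilpotent.

(** * Moments of the triple product *)

Section Moments.
Local Open Scope ring_scope.
Variable R : comNzRingType.
Implicit Types (f g : {poly R}) (c k n : nat).

(* [z d/dz - c], i.e. [z d/dz] for a Laurent polynomial stored as [z^c] times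
   itself. *)
Definition ceuler c f : {poly R} := 'X * f^`() - c%:R * f.

Lemma ceulerM c c' f g :
  ceuler (c + c') (f * g) = ceuler c f * g + f * ceuler c' g.
Proof. by rewrite /ceuler derivM natrD; ring. Qed.

Lemma ceulerD c f g : ceuler c (f + g) = ceuler c f + ceuler c g.
Proof. by rewrite /ceuler derivD; ring. Qed.

Lemma ceuler0 c : ceuler c 0 = 0.
Proof. by rewrite /ceuler deriv0; ring. Qed.

Lemma ceulerC a : ceuler 0 a%:P = 0.
Proof. by rewrite /ceuler derivC; ring. Qed.

Lemma ceuler_sum c I (r : seq I) (P : pred I) (F : I -> {poly R}) :
  ceuler c (\sum_(i <- r | P i) F i) = \sum_(i <- r | P i) ceuler c (F i).
Proof. exact: (big_morph _ (ceulerD c) (ceuler0 c)). Qed.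

Lemma ceulerMC c a f : ceuler c (a%:P * f) = a%:P * ceuler c f.
Proof. by rewrite -(add0n c) ceulerM ceulerC mul0r add0r. Qed.

Lemma ceulerXn c n : ceuler c 'X^n = (n%:R - c%:R)%:P * 'X^n.
Proof.
rewrite /ceuler derivXn polyCB !rmorph_nat mulrBl; congr (_ - _).
by case: n => [|n]; rewrite ?mulr0n ?mulr0 ?mul0r // mulrnAr -exprS mulr_natl.
Qed.

Lemma iter_ceulerM k c c' f g :
  iter k (ceuler (c + c')) (f * g) =
  \sum_(i < k.+1) 'C(k, i)%:R * (iter i (ceuler c) f * iter (k - i) (ceuler c') g).
Proof.
elim: k => [|k IH]; first by rewrite big_ord1 /= mul1r.
rewrite iterS IH ceuler_sum.
pose t i j := iter i (ceuler c) f * iter j (ceuler c') g.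
rewrite (eq_bigr (fun i : 'I_k.+1 =>
   'C(k, i)%:R * t i.+1 (k - i)%N + 'C(k, i)%:R * t i (k - i)%N.+1)); last first.
  by move=> i _; rewrite -!polyC_natr ceulerMC ceulerM mulrDr.
rewrite big_split /= big_ord_recr /= [X in _ + X]big_ord_recl /=.
rewrite [RHS]big_ord_recl [X in _ = _ + X]big_ord_recr /=.
rewrite !subn0 !bin0 !binn !subnn addrCA; congr (_ + _).
rewrite addrAC; congr (_ + _); rewrite -big_split /=.
apply: eq_bigr => i _; rewrite /bump /= !add1n binS natrD subSS.
have -> : (k - i = (k - i.+1).+1)%N by have := ltn_ord i; lia.
by rewrite /t add0n -mulrDl ['C(k, i)%:R + _]addrC.
Qed.

(** For [f = sum a_j X^j] this is [sum a_j (j - c)^k], the moment of the exponents measured from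
    [c]. *)
Definition moment c k f : R := (iter k (ceuler c) f).[1].

Lemma momentM c c' k f g : moment (c + c') k (f * g) =
  \sum_(i < k.+1) 'C(k, i)%:R * (moment c i f * moment c' (k - i) g).
Proof.
rewrite /moment iter_ceulerM horner_sum; apply: eq_bigr => i _.
by rewrite -polyC_natr !hornerM hornerC.
Qed.

Lemma momentD c k f g : moment c k (f + g) = moment c k f + moment c k g.
Proof.
rewrite /moment -hornerD; congr (_.[_]).
by elim: k => //= k ->; rewrite ceulerD.
Qed.

Lemma moment0 c k : moment c k 0 = 0.
Proof.
rewrite /moment; have -> : iter k (ceuler c) 0 = 0; last by rewrite horner0.
by elim: k => //= k ->; rewrite ceuler0.
Qed.

Lemma moment_sum c k I (r : seq I) (P : pred I) (F : I -> {poly R}) :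
  moment c k (\sum_(i <- r | P i) F i) = \sum_(i <- r | P i) moment c k (F i).
Proof. exact: (big_morph _ (momentD c k) (moment0 c k)). Qed.

Lemma momentMC c k a f : moment c k (a%:P * f) = a * moment c k f.
Proof.
rewrite /moment; have -> : iter k (ceuler c) (a%:P * f) = a%:P * iter k (ceuler c) f.
  by elim: k => //= k ->; rewrite ceulerMC.
by rewrite hornerM hornerC.
Qed.

Lemma momentXn c k n : moment c k 'X^n = (n%:R - c%:R) ^+ k.
Proof.
rewrite /moment.
have -> : iter k (ceuler c) 'X^n = ((n%:R - c%:R) ^+ k)%:P * 'X^n.
  elim: k => [|k IH] /=; first by rewrite expr0 mul1r.
  by rewrite IH ceulerMC ceulerXn exprSr polyCM mulrA.
by rewrite hornerM hornerC hornerXn expr1n mulr1.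
Qed.

Lemma momentXnM c k n f : moment (c + n) k (f * 'X^n) = moment c k f.
Proof.
rewrite /moment; have -> : iter k (ceuler (c + n)) (f * 'X^n) = iter k (ceuler c) f * 'X^n.
  elim: k => //= k ->; rewrite ceulerM ceulerXn subrr mul0r mulr0 addr0 //.
by rewrite hornerM hornerXn expr1n mulr1.
Qed.

Lemma momentS c k f : moment c k.+1 f = moment c k (ceuler c f).
Proof. by rewrite /moment iterSr. Qed.

End Moments.

(** * Series and logarithmic derivative of the triple product *)

Section Jacobi.
Local Open Scope ring_scope.
Variables (R : comNzRingType) (q : R) (N : nat).
Hypothesis qN : q ^+ N = 0.

Let m := N.*2.
Let Q : {poly R} := q%:P.

Let QN : Q ^+ N = 0. Proof. by rewrite -polyC_exp qN. Qed.

(** Since [X - q^j = X (1 - q^j / X)], this is the triple product without [qpoch] and [1 - X],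
    stored with centre [a]. *)
Definition theta_prod (a : nat) : {poly R} :=
  \prod_(j < a) (('X - Q ^+ j.+1) * (1 - 'X * Q ^+ j.+1)).

(** Division of the theta series by [1 - X] pairs the powers [-n] and [n + 1] into the geometric sum
    over [|i| <= n]; the shift by [m] keeps exponents natural. *)
Definition theta_series : {poly R} :=
  \sum_(n < m.+1) ((-1) ^+ n * q ^+ 'C(n.+1, 2))%:P *
    \sum_(i < n.*2.+1) 'X^(m - n + i).

Lemma geomX n : (n <= m)%N ->
  (1 - 'X) * \sum_(i < n.*2.+1) 'X^(m - n + i) = 'X^(m - n) - 'X^(m + n.+1) :> {poly R}.
Proof.
move=> nm; rewrite (eq_bigr (fun i : 'I_n.*2.+1 => 'X^(m - n) * 'X^i : {poly R})); last first.
  by move=> i _; rewrite exprD.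
rewrite -mulr_sumr mulrCA -opprB mulNr -subrX1 opprB mulrBr mulr1 -exprD.
by congr (_ - 'X^_); lia.
Qed.

(** After multiplication by the regular element [1 - X], this is the triple product with [x = w = X]
    and [y = q]. *)
Lemma theta_prodE : (qpoch q N)%:P * theta_prod m = theta_series.
Proof.
have reg : GRing.lreg (1 - 'X : {poly R}).
  rewrite -opprB; apply: lregN; rewrite -[1]/(1%:P).
  exact/monic_lreg/monicXsubC.
apply: reg; rewrite mulrCA.
have -> : (1 - 'X) * theta_prod m =
   \prod_(j < m) ('X - Q * Q ^+ j) * \prod_(j < m) (1 - 'X * Q ^+ j).
  rewrite /theta_prod big_split /= mulrCA; congr (_ * _).
    by apply: eq_bigr => j _; rewrite exprS.
  (* The factor [j = 0] is [1 - X], and the factor [j = m] is 1 by nilpotency. *)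
  transitivity (\prod_(j < m.+1) (1 - 'X * Q ^+ j)).
    by rewrite big_ord_recl expr0 mulr1.
  by rewrite big_ord_recr /= (expr_nil QN) ?mulr0 ?subr0 ?mulr1 // /m; lia.
have -> : (qpoch q N)%:P = qpoch Q N.
  rewrite /qpoch rmorph_prod; apply: eq_bigr => j _.
  by rewrite rmorphB rmorph1 rmorphXn.
rewrite (triple_product QN (mulrC 'X Q)) -/m.
rewrite /theta_series mulr_sumr.
rewrite (eq_bigr (fun n : 'I_m.+1 => ((-1) ^+ n * q ^+ 'C(n.+1, 2))%:P * 'X^(m - n)
    - ((-1) ^+ n * q ^+ 'C(n.+1, 2))%:P * 'X^(m + n.+1))); last first.
  move=> n _; rewrite mulrCA geomX ?mulrBr //; have := ltn_ord n; lia.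
rewrite big_split /= -(big_mkord xpredT (fun k => (-1) ^+ (m + k) * theta_term Q 'X Q 'X m k)).
(* The terms [k <= m], read backwards with [n = m - k], give the powers [X^(m-n)]; the others give
   [X^(m+n+1)] with [n = k - m - 1]. *)
rewrite (@big_cat_nat _ _ _ m.+1) //=; last by lia.
congr (_ + _).
  rewrite big_mkord (reindex_inj rev_ord_inj) /=; apply: eq_bigr => n _.
  have nm : (n <= m)%N by have := ltn_ord n; lia.
  rewrite subSS /theta_term leq_subr subKn // binS bin1.
  have -> : (-1) ^+ (m + (m - n)) = (-1) ^+ n :> {poly R}.
    have -> : (m + (m - n) = n + (m - n).*2)%N by lia.
    by rewrite exprD -mul2n exprM sqrrN !expr1n mulr1.
  rewrite rmorphM rmorphXn rmorphN1 rmorphXn addnC exprD /Q; ring.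
rewrite [RHS]big_ord_recr /= (expr_nil qN) ?mulr0 ?mul0r ?oppr0 ?addr0; last first.
  by rewrite binS bin1 /m; lia.
rewrite -{1}[m.+1]add0n big_addn subSS addnK big_mkord.
apply: eq_bigr => n _.
rewrite /theta_term; have -> : (n + m.+1 <= m)%N = false by lia.
have -> : (n + m.+1 - m = n.+1)%N by lia.
have -> : (-1) ^+ (m + (n + m.+1)) = - (-1) ^+ n :> {poly R}.
  have -> : (m + (n + m.+1) = n.+1 + m.*2)%N by lia.
  by rewrite exprD exprS -mul2n exprM sqrrN !expr1n mulr1 mulN1r.
by rewrite rmorphM rmorphXn rmorphN1 rmorphXn exprD /Q; ring.
Qed.

Definition theta_moment (k : nat) : R :=
  \sum_(n < m.+1) (-1) ^+ n * q ^+ 'C(n.+1, 2) *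
    \sum_(i < n.*2.+1) (i%:R - n%:R) ^+ k.

Lemma moment_theta_prod k :
  qpoch q N * moment m k (theta_prod m) = theta_moment k.
Proof.
rewrite -momentMC theta_prodE /theta_series moment_sum; apply: eq_bigr => n _.
rewrite momentMC moment_sum; congr (_ * _); apply: eq_bigr => i _.
rewrite momentXn; congr (_ ^+ _).
have nm : (n <= m)%N by have := ltn_ord n; lia.
by rewrite natrD natrB //; ring.
Qed.

(** Jacobi's series for the cube of the Euler product: at [X = 1] the polynomial [theta_prod m]
    contributes a square. *)
Lemma theta_moment0 : theta_moment 0 = qpoch q N ^+ 3.
Proof.
rewrite -moment_theta_prod /moment /= /theta_prod horner_prod.
have h : \prod_(j < m) (('X - Q ^+ j.+1) * (1 - 'X * Q ^+ j.+1)).[1] = qpoch q N ^+ 2.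
  rewrite -(@qpoch_nil _ _ _ qN m) ?/m -?addnn ?leq_addr // /qpoch expr2 -big_split /=.
  apply: eq_bigr => j _.
  by rewrite /Q -polyC_exp !hornerE.
by rewrite h exprS.
Qed.

Definition lambert_series (a : nat) : {poly R} :=
  \sum_(n < a) \sum_(j < N)
     (q ^+ (n.+1 * j.+1))%:P * ('X^(N - j.+1) - 'X^(N + j.+1)).

(** The geometric expansion of [u / (X - u)], cut off by [u^N = 0]. *)
Lemma telescope_left (u : R) : u ^+ N = 0 ->
  ('X - u%:P) * \sum_(j < N) (u ^+ j.+1)%:P * 'X^(N - j.+1) = u%:P * 'X^N.
Proof.
move=> uN.
suff h k : (k <= N)%N ->
  ('X - u%:P) * \sum_(j < k) (u ^+ j.+1)%:P * 'X^(N - j.+1) =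
  u%:P * 'X^N - (u ^+ k.+1)%:P * 'X^(N - k).
  by rewrite h // exprS uN mulr0 mul0r subr0.
elim: k => [|k IH] kN; first by rewrite big_ord0 mulr0 subn0 expr1 subrr.
rewrite big_ord_recr /= mulrDr IH; last by lia.
have -> : (N - k = (N - k.+1).+1)%N by lia.
by rewrite !exprS !polyCM; ring.
Qed.

Lemma telescope_right (u : R) : u ^+ N = 0 ->
  (1 - 'X * u%:P) * \sum_(j < N) (u ^+ j.+1)%:P * 'X^(N + j.+1) = u%:P * 'X * 'X^N.
Proof.
move=> uN.
suff h k :
  (1 - 'X * u%:P) * \sum_(j < k) (u ^+ j.+1)%:P * 'X^(N + j.+1) =
  u%:P * 'X * 'X^N - (u ^+ k.+1)%:P * 'X^(N + k.+1).
  by rewrite h // exprS uN mulr0 mul0r subr0.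
elim: k => [|k IH].
  by rewrite big_ord0 mulr0 addn1 expr1 exprS mulrA subrr.
rewrite big_ord_recr /= mulrDr IH !addnS !exprS !polyCM; ring.
Qed.

(* The logarithmic derivative of [theta_prod], with denominators cleared by
   nilpotency and centred at [X^N] to avoid negative powers. *)
Lemma ceuler_theta_prod a :
  ceuler a (theta_prod a) * 'X^N = theta_prod a * lambert_series a.
Proof.
elim: a => [|a IH].
  rewrite /theta_prod /lambert_series !big_ord0 mulr0 -[1]/(1%:P) ceulerC.
  by rewrite mul0r.
rewrite /theta_prod big_ord_recr /= -/(theta_prod a) -addn1 ceulerM.
rewrite addn1 /lambert_series big_ord_recr /= -/(lambert_series a).
set u := q ^+ a.+1.
have uN : u ^+ N = 0 by rewrite /u -exprM mulnC exprM qN expr0n.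
have -> : Q ^+ a.+1 = u%:P by rewrite /Q -polyC_exp.
rewrite (eq_bigr (fun j : 'I_N => (u ^+ j.+1)%:P * 'X^(N - j.+1)
     - (u ^+ j.+1)%:P * 'X^(N + j.+1))); last first.
  by move=> j _; rewrite mulrBr /u -exprM.
rewrite big_split /= sumrN.
have -> : ceuler 1 (('X - u%:P) * (1 - 'X * u%:P)) =
   u%:P * (1 - 'X * u%:P) - 'X * u%:P * ('X - u%:P).
  rewrite -[1%N]/(1 + 0)%N ceulerM.
  rewrite /ceuler !derivE.
  by ring.
have e1 := telescope_left uN; have e2 := telescope_right uN.
set A := \sum_(j < N) _ in e1 *; set B := \sum_(j < N) _ in e2 *.
transitivity (ceuler a (theta_prod a) * 'X^N * (('X - u%:P) * (1 - 'X * u%:P))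
   + theta_prod a * ((u%:P * 'X^N) * (1 - 'X * u%:P)
       - (u%:P * 'X * 'X^N) * ('X - u%:P))); first by ring.
by rewrite IH -e1 -e2; ring.
Qed.

Definition lambert_moment (i : nat) : R :=
  \sum_(n < m) \sum_(j < N) q ^+ (n.+1 * j.+1) * ((- j.+1%:R) ^+ i - j.+1%:R ^+ i).

Lemma moment_lambert i : moment N i (lambert_series m) = lambert_moment i.
Proof.
rewrite moment_sum; apply: eq_bigr => n _; rewrite moment_sum.
apply: eq_bigr => j _; rewrite momentMC; congr (_ * _).
have -> : - 'X^(N + j.+1) = (-1)%:P * 'X^(N + j.+1) :> {poly R}.
  by rewrite rmorphN1 mulN1r.
have jN := ltn_ord j.
rewrite momentD momentMC !momentXn mulN1r natrB // natrD.
by congr (_ ^+ _ - _ ^+ _); ring.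
Qed.

(** One Euler derivative turns the product into itself times the Lambert series; the remaining [k]
    are spread by Leibniz's rule. *)
Lemma theta_momentS k : theta_moment k.+1 =
  \sum_(i < k.+1) 'C(k, i)%:R * (lambert_moment i * theta_moment (k - i)).
Proof.
rewrite -moment_theta_prod momentS -(momentXnM _ _ N) ceuler_theta_prod.
rewrite mulrC addnC [theta_prod m * _]mulrC momentM mulrC mulr_sumr; apply: eq_bigr => i _.
by rewrite moment_lambert -moment_theta_prod; ring.
Qed.

(** The series [sum sigma_i(n) q^n] in Lambert form: the exponent appears factored, and [j.+1] is
    the divisor raised to the power [i]. *)
Definition S_series (i : nat) : R :=
  \sum_(n < m) \sum_(j < N) j.+1%:R ^+ i * q ^+ (n.+1 * j.+1).

Lemma lambert_moment_even i : ~~ odd i -> lambert_moment i = 0.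
Proof.
move=> ei; rewrite /lambert_moment big1 // => n _; rewrite big1 // => j _.
by rewrite exprNn -signr_odd (negPf ei) expr0 mul1r subrr mulr0.
Qed.

Lemma lambert_moment_odd i : odd i -> lambert_moment i = - S_series i *+ 2.
Proof.
move=> oi; rewrite /lambert_moment /S_series -sumrN -sumrMnl.
apply: eq_bigr => n _; rewrite -sumrN -sumrMnl; apply: eq_bigr => j _.
rewrite exprNn -signr_odd oi expr1; ring.
Qed.

End Jacobi.

(** * Euler's pentagonal number theorem *)

Section Pentagonal.
Local Open Scope ring_scope.
Variables (R : comNzRingType) (q : R) (N : nat).
Hypothesis (qN : q ^+ N = 0).

(** The triple product with base [q^3], [x = q], [y = q^2] and [w = 1]: its factors cover the three
    classes of exponents modulo 3. *)
Lemma pentagonal : qpoch q N =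
  \sum_(k < (N.*2 + N.*2).+1) (-1) ^+ (N.*2 + k) * theta_term (q ^+ 3) q (q ^+ 2) 1 N.*2 k.
Proof.
set m := N.*2.
have QN : (q ^+ 3) ^+ N = 0 by rewrite -exprM mulnC exprM qN expr0n.
have e : q * q ^+ 2 = q ^+ 3 * 1 by rewrite mulr1 -exprS.
rewrite -(triple_product QN e) -/m.
rewrite -(@qpoch_nil _ _ _ QN m) -?(@qpoch_nil _ _ _ qN (3 * m)%N); try by rewrite /m; lia.
rewrite /qpoch.
elim: m => [|a IH]; first by rewrite !big_ord0 !mulr1.
have -> : (3 * a.+1 = (3 * a).+3)%N by lia.
rewrite !big_ord_recr /= IH -!exprM -exprD.
have -> : q * q ^+ (3 * a) = q ^+ (3 * a).+1 by rewrite exprS.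
have -> : (2 + 3 * a = (3 * a).+2)%N by lia.
have -> : (3 * a.+1 = (3 * a).+3)%N by lia.
by ring.
Qed.

End Pentagonal.

(** * Power sums over symmetric intervals *)

Section PowerSums.
Local Open Scope ring_scope.
Variable R : comNzRingType.

Definition cpsum (k n : nat) : R := \sum_(i < n.*2.+1) (i%:R - n%:R) ^+ k.

Lemma cpsumS k n :
  cpsum k n.+1 = cpsum k n + n.+1%:R ^+ k + (- n.+1%:R) ^+ k.
Proof.
rewrite /cpsum doubleS big_ord_recl big_ord_recr /= sub0r [LHS]addrC.
congr (_ + _ + _).
  by apply: eq_bigr => i _; congr (_ ^+ _); rewrite /bump /= natrD -natr1; ring.
congr (_ ^+ _); rewrite /bump /= -addnn.
have -> : (1 + (n + n).+1 = n.+1 + n.+1)%N by lia.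
by rewrite natrD addrK.
Qed.

Lemma cpsum0n k : cpsum k 0 = 0 ^+ k.
Proof. by rewrite /cpsum big_ord1 subrr. Qed.

Lemma cpsum0 n : cpsum 0 n = n.*2.+1%:R.
Proof. by rewrite /cpsum (eq_bigr (fun=> 1)) // sumr_const card_ord. Qed.

Let X n : R := n%:R * n.+1%:R.

(** Here and below the denominators are cleared, to be inverted modulo [l]. In terms of [X n], twice
    a triangular number, the cofactor of [2n+1] depends only on the exponent of [q]. *)
Lemma cpsum2 n : 3 * cpsum 2 n = n.*2.+1%:R * X n.
Proof.
elim: n => [|n IH]; first by rewrite cpsum0n /X; ring.
rewrite cpsumS !mulrDr IH /X -!muln2; ring.
Qed.

Lemma cpsum4 n : 15 * cpsum 4 n = n.*2.+1%:R * X n * (3 * X n - 1).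
Proof.
elim: n => [|n IH]; first by rewrite cpsum0n /X; ring.
rewrite cpsumS !mulrDr IH /X -!muln2; ring.
Qed.

Lemma cpsum6 n : 21 * cpsum 6 n = n.*2.+1%:R * X n * (3 * X n ^+ 2 - 3 * X n + 1).
Proof.
elim: n => [|n IH]; first by rewrite cpsum0n /X; ring.
rewrite cpsumS !mulrDr IH /X -!muln2; ring.
Qed.

Lemma cpsum8 n : 45 * cpsum 8 n =
  n.*2.+1%:R * X n * (5 * X n ^+ 3 - 10 * X n ^+ 2 + 9 * X n - 3).
Proof.
elim: n => [|n IH]; first by rewrite cpsum0n /X; ring.
rewrite cpsumS !mulrDr IH /X -!muln2; ring.
Qed.

End PowerSums.

(** * Truncated power series modulo l *)

Section Truncated.
Local Open Scope ring_scope.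
Variables (l : nat) (l_prime : prime l) (d : nat).
Let N := d.+1.

Local Notation tser := {poly %/ ('X^(d.+1) : {poly 'F_l})}.

Definition tq : tser := in_qpoly _ 'X.
Definition tcoef (i : nat) (x : tser) : 'F_l := (x : {poly 'F_l})`_i.

Lemma tcoefD i x y : tcoef i (x + y) = tcoef i x + tcoef i y.
Proof. by rewrite /tcoef coefD. Qed.
Lemma tcoef0 i : tcoef i 0 = 0.
Proof. by rewrite /tcoef coef0. Qed.
Lemma tcoefN i x : tcoef i (- x) = - tcoef i x.
Proof. by apply/eqP; rewrite -addr_eq0 -tcoefD addNr tcoef0. Qed.
Lemma tcoefZ i a (x : tser) : tcoef i (a *: x) = a * tcoef i x.
Proof. by rewrite /tcoef coefZ. Qed.
Lemma tcoef_sum i I (r : seq I) (P : pred I) (F : I -> tser) :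
  tcoef i (\sum_(j <- r | P j) F j) = \sum_(j <- r | P j) tcoef i (F j).
Proof. exact: (big_morph _ (tcoefD i) (tcoef0 i)). Qed.
Lemma tcoef_nat i c x : tcoef i (c%:R * x) = c%:R * tcoef i x.
Proof.
by rewrite !mulr_natl; elim: c => [|c IH]; rewrite ?tcoef0 // !mulrS tcoefD IH.
Qed.

Lemma tcoefM i x y : (i < N)%N ->
  tcoef i (x * y) = \sum_(j < i.+1) tcoef j x * tcoef (i - j) y.
Proof.
move=> iN; rewrite /tcoef poly_of_qpolyM; move: (polyn x) (polyn y) => u v.
rewrite mk_monic_Xn -Pdiv.RingMonic.take_poly_rmodp.
by rewrite coef_take_poly iN coefM.
Qed.

Lemma tqXE k : tq ^+ k = in_qpoly _ 'X^k :> tser.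
Proof. by rewrite rmorphXn. Qed.

Lemma tcoef_tqX i k : (i < N)%N -> tcoef i (tq ^+ k) = (i == k)%:R.
Proof.
move=> iN; rewrite tqXE /tcoef /= mk_monic_Xn -Pdiv.RingMonic.take_poly_rmodp.
by rewrite coef_take_poly iN coefXn.
Qed.

Lemma tser_ext (x y : tser) :
  (forall i, (i < N)%N -> tcoef i x = tcoef i y) -> x = y.
Proof.
move=> h; apply: val_inj; apply/polyP => i; have [/h//|iN] := ltnP i N.
by rewrite !big_coef_npoly // mk_monic_Xn size_polyXn.
Qed.

Lemma tqN : tq ^+ N = 0.
Proof. by apply: tser_ext => i iN; rewrite tcoef_tqX // tcoef0 ltn_eqF. Qed.

Lemma tcoef_tqXM i k x : (i < N)%N ->
  tcoef i (tq ^+ k * x) = if (k <= i)%N then tcoef (i - k) x else 0.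
Proof.
move=> iN; rewrite tcoefM //; case: leqP => ki.
  have kS : (k < i.+1)%N by [].
  rewrite (bigD1 (Ordinal kS)) //= tcoef_tqX ?(leq_ltn_trans ki) // eqxx mul1r.
  rewrite big1 ?addr0 // => j jk; rewrite tcoef_tqX; last by have := ltn_ord j; lia.
  by move/negPf: jk; rewrite -val_eqE /= => ->; rewrite mul0r.
rewrite big1 // => j _; have := ltn_ord j => ji.
by rewrite tcoef_tqX ?ltn_eqF ?mul0r //; lia.
Qed.

Lemma tser_decomp (x : tser) : x = \sum_(i < N) tcoef i x *: tq ^+ i.
Proof.
apply: tser_ext => i iN; rewrite tcoef_sum (bigD1 (Ordinal iN)) //=.
rewrite tcoefZ tcoef_tqX // eqxx mulr1 big1 ?addr0 // => j.
rewrite -val_eqE /= => /negPf ji.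
by rewrite tcoefZ tcoef_tqX // eq_sym ji mulr0.
Qed.

Lemma tser_pchar : l \in [pchar tser].
Proof. by rewrite pchar_qpoly pchar_Fp. Qed.

Lemma tser_l0 : l%:R = 0 :> tser.
Proof. exact: pcharf0 tser_pchar. Qed.

Lemma natr_Fl_eq0 c : (c%:R == 0 :> 'F_l) = (l %| c)%N.
Proof. by rewrite -(dvdn_pcharf (pchar_Fp l_prime)). Qed.

(** Supports modulo [l]: [graded] confines them to one class and is multiplicative, while [avoids]
    excludes one class and expresses the desired congruences. *)
Definition graded (r : nat) (x : tser) : Prop :=
  forall i, (i < N)%N -> i != r %[mod l] -> tcoef i x = 0.
Definition avoids (r : nat) (x : tser) : Prop :=
  forall i, (i < N)%N -> i = r %[mod l] -> tcoef i x = 0.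

Lemma graded_sum r I (s : seq I) (P : pred I) (F : I -> tser) :
  (forall j, P j -> graded r (F j)) -> graded r (\sum_(j <- s | P j) F j).
Proof.
by move=> h i iN ir; rewrite tcoef_sum big1 // => j Pj; apply: h.
Qed.

Lemma graded_tqX k : graded k (tq ^+ k).
Proof.
by move=> i iN ik; rewrite tcoef_tqX //; case: (i =P k) ik => // ->; rewrite eqxx.
Qed.

Lemma graded_mod r s x : r = s %[mod l] -> graded r x -> graded s x.
Proof. by move=> rs h i iN is'; apply: h => //; rewrite rs. Qed.

Lemma gradedM r s x y : graded r x -> graded s y -> graded (r + s) (x * y).
Proof.
move=> gx gy i iN irs; rewrite tcoefM // big1 // => j _; have := ltn_ord j => ji.
have [jr|jr] := eqVneq (j %% l)%N (r %% l)%N; last first.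
  by rewrite gx ?mul0r // (leq_ltn_trans (ltnSE ji) iN).
rewrite gy ?mulr0 //; first exact: leq_ltn_trans (leq_subr _ _) iN.
apply: contra irs => /eqP e.
by rewrite -{1}(subnKC (ltnSE ji)) -modnDm jr e modnDm.
Qed.

Lemma gradedZ r a x : graded r x -> graded r (a *: x).
Proof. by move=> gx i iN ir; rewrite tcoefZ gx // mulr0. Qed.

Lemma graded_nat r c x : graded r x -> graded r (c%:R * x).
Proof. by move=> gx i iN ir; rewrite tcoef_nat gx // mulr0. Qed.

Lemma graded1 : graded 0 1.
Proof. by rewrite -(expr0 tq); apply: graded_tqX. Qed.

Lemma gradedX r k x : graded r x -> graded (r * k) (x ^+ k).
Proof.
move=> gx; elim: k => [|k IH]; first by rewrite muln0; exact: graded1.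
by rewrite exprS mulnS; apply: gradedM.
Qed.

Lemma graded_sign r k x : graded r x -> graded r ((-1) ^+ k * x).
Proof.
rewrite -signr_odd; case: (odd k); rewrite ?mul1r // mulN1r => gx i iN ir.
by rewrite tcoefN gx // oppr0.
Qed.

Lemma avoids_graded r s x : r != s %[mod l] -> graded s x -> avoids r x.
Proof. by move=> rs gx i iN ir; apply: gx => //; rewrite ir. Qed.

Lemma avoids_sum r I (s : seq I) (P : pred I) (F : I -> tser) :
  (forall j, P j -> avoids r (F j)) -> avoids r (\sum_(j <- s | P j) F j).
Proof. by move=> h i iN ir; rewrite tcoef_sum big1 // => j Pj; apply: h. Qed.

Lemma avoidsM r x y : avoids r x -> graded 0 y -> avoids r (x * y).
Proof.
move=> ax gy i iN ir; rewrite tcoefM // big1 // => j _; have := ltn_ord j => ji.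
have [e|e] := eqVneq ((i - j) %% l)%N (0 %% l)%N; last first.
  by rewrite gy ?mulr0 // (leq_ltn_trans (leq_subr _ _) iN).
rewrite ax ?mul0r //; first exact: leq_ltn_trans (ltnSE ji) iN.
by rewrite -ir -[in RHS](subnKC (ltnSE ji)) -modnDmr e mod0n addn0.
Qed.

Lemma graded_avoids0 r x : graded r x -> avoids r x -> x = 0.
Proof.
move=> gx ax; apply: tser_ext => i iN; rewrite tcoef0.
by have [/ax|/gx] := eqVneq (i %% l)%N (r %% l)%N; apply.
Qed.

(** In characteristic [l] the [l]-th power is additive, so only powers of [q^l] arise. *)
Lemma graded_Frobenius (x : tser) : graded 0 (x ^+ l).
Proof.
rewrite (tser_decomp x) -(pFrobenius_autE tser_pchar).
rewrite (big_morph _ (fun a b => pFrobenius_autD_comm tser_pchar (mulrC a b))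
  (pFrobenius_aut0 tser_pchar)).
apply: graded_sum => i _; rewrite pFrobenius_autE exprZn; apply: gradedZ.
rewrite -exprM; apply: (@graded_mod (i * l)); last exact: graded_tqX.
by rewrite modnMl mod0n.
Qed.

Definition gser (a : nat -> nat) : tser := \sum_(i < N) (a i)%:R * tq ^+ i.

Lemma tcoef_gser a i : (i < N)%N -> tcoef i (gser a) = (a i)%:R.
Proof.
move=> iN; rewrite tcoef_sum (bigD1 (Ordinal iN)) //=.
rewrite tcoef_nat tcoef_tqX // eqxx mulr1 big1 ?addr0 // => j.
rewrite -val_eqE /= => /negPf ji.
by rewrite tcoef_nat tcoef_tqX // eq_sym ji mulr0.
Qed.

(** Multiplication by [1 - q^(k+1)] undoes [pk_rec]. *)
Lemma gser_pk k : qpoch tq k * gser (pk k) = 1.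
Proof.
elim: k => [|k IH].
  rewrite /qpoch big_ord0 mul1r; apply: tser_ext => i iN.
  by rewrite tcoef_gser // pk0 -(expr0 tq) tcoef_tqX.
rewrite qpochS -mulrA -[RHS]IH; congr (_ * _); apply: tser_ext => i iN.
rewrite mulrBl mul1r tcoefD tcoefN tcoef_tqXM //.
rewrite [tcoef i (gser _)]tcoef_gser // [RHS]tcoef_gser // pk_rec natrD.
case: ltnP => ki; last by rewrite addr0 subr0.
by rewrite tcoef_gser ?addrK // (leq_ltn_trans (leq_subr _ _) iN).
Qed.

Lemma gser_p : qpoch tq N * gser p = 1.
Proof.
rewrite -(gser_pk N); congr (_ * _); apply: tser_ext => i iN.
by rewrite !tcoef_gser // pk_p // ltnW.
Qed.

Lemma gser_F k J : gser (F k.+1) =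
  \sum_(j < J) tq ^+ (j.+1 * k.+1) * gser p + tq ^+ (J * k.+1) * gser (F k.+1).
Proof.
elim: J => [|J IH]; first by rewrite big_ord0 mul0n mul1r add0r.
rewrite {1}IH big_ord_recr /= -addrA; congr (_ + _).
rewrite mulSnr exprD -!mulrA -!mulrDr; congr (_ * _).
apply: tser_ext => i iN; rewrite tcoef_tqXM // [LHS]tcoef_gser //.
case: ltnP => ki; last by rewrite F_small.
have iN' : (i - k.+1 < N)%N by apply: leq_ltn_trans (leq_subr _ _) iN.
by rewrite tcoefD !tcoef_gser // F_rec ?natrD.
Qed.

Lemma gser_M m : gser (M m) = S_series tq N m * gser p.
Proof.
rewrite /S_series exchange_big mulr_suml.
rewrite (eq_bigr (fun k : 'I_N => (k.+1%:R ^+ m) * gser (F k.+1))); last first.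
  (* Unfolding [2 N] times matches the outer range of [S_series]; the remainder vanishes by
     nilpotency. *)
  move=> k _; rewrite (gser_F k N.*2).
  rewrite (expr_nil tqN) ?mul0r ?addr0; last by lia.
  by rewrite -mulr_sumr -mulrA -mulr_suml.
apply: tser_ext => i iN; rewrite tcoef_gser // tcoef_sum /M.
rewrite natr_sum.
transitivity (\sum_(1 <= k < N.+1) (k ^ m * F k i)%:R : 'F_l).
  rewrite [RHS](@big_cat_nat _ _ _ i.+1) ?ltnS ?(ltnW iN) //=.
  rewrite [X in _ = _ + X]big_nat_cond [X in _ = _ + X]big1 ?addr0 // => k.
  by move=> /andP[/andP[ik _] _]; rewrite F_small // muln0.
rewrite big_add1 big_mkord; apply: eq_bigr => k _.
by rewrite -natrX tcoef_nat tcoef_gser // natrM.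
Qed.

Lemma pentagonal_avoids r :
  (forall j, (3 * 'C(j, 2) + j != r %[mod l])%N /\ (3 * 'C(j, 2) + 2 * j != r %[mod l])%N) ->
  avoids r (qpoch tq N).
Proof.
move=> h; rewrite (pentagonal tqN).
apply: avoids_sum => k _; rewrite /theta_term.
case: leqP => _; rewrite expr1n mulr1 -!exprM -exprD; set e := (_ + 3 * _)%N.
  apply: (@avoids_graded _ e); last by apply: graded_sign; apply: graded_tqX.
  by rewrite eq_sym /e addnC (h _).2.
apply: (@avoids_graded _ e); last by apply: graded_sign; apply: graded_tqX.
by rewrite eq_sym /e addnC (h _).1.
Qed.

End Truncated.

(** * Sparse polynomials in the residue parts of J *)

(* A term [(c, e)] of a sparse polynomial is [c * x_0 ^ e_0 * x_1 ^ e_1 * ...];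
   exponent lists carry no trailing zeros, so that equal monomials are equal
   lists. *)
Notation spoly := (seq (nat * seq nat)).

Fixpoint madd (e f : seq nat) : seq nat :=
  match e, f with
  | a :: e', b :: f' => a + b :: madd e' f'
  | [::], _ => f
  | _, [::] => e
  end.

(** The residue class of a monomial whose variables are series supported on the classes listed in
    [V]. *)
Fixpoint mres (V e : seq nat) : nat :=
  match V, e with r :: V', a :: e' => r * a + mres V' e' | _, _ => 0 end.

Fixpoint sinsert (l : nat) (t : nat * seq nat) (P : spoly) : spoly :=
  if P is u :: P' then
    if t.2 == u.2 then ((t.1 + u.1) %% l, u.2) :: P' else u :: sinsert l t P'
  else [:: t].

Definition snorm (l : nat) (P : spoly) : spoly := foldr (sinsert l) [::] P.

Definition smul (l : nat) (P Q : spoly) : spoly :=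
  [seq ((t.1 * u.1) %% l, madd t.2 u.2) | t <- P, u <- Q].

Definition smuln (l : nat) (P Q : spoly) : spoly := snorm l (smul l P Q).

Fixpoint spow (l : nat) (P : spoly) (k : nat) : spoly :=
  if k is k'.+1 then smuln l P (spow l P k') else [:: (1, [::])].

Fixpoint slin (V : seq nat) (c : nat -> nat) : spoly :=
  if V is r :: V' then
    (c r, [:: 1]) :: [seq (t.1, 0 :: t.2) | t <- slin V' c]
  else [::].

Definition spart (l : nat) (V : seq nat) (r : nat) (P : spoly) : spoly :=
  [seq t <- P | mres V t.2 == r %[mod l]].

Section SparseEval.
Local Open Scope ring_scope.
Variables (R : comNzRingType) (l : nat).
Hypothesis l0 : l%:R = 0 :> R.

Fixpoint meval (xs : seq R) (e : seq nat) : R :=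
  match xs, e with x :: xs', a :: e' => x ^+ a * meval xs' e' | _, _ => 1 end.

Definition seval (xs : seq R) (P : spoly) : R :=
  \sum_(t <- P) t.1%:R * meval xs t.2.

Lemma natr_modl a : (a %% l)%:R = a%:R :> R.
Proof. by rewrite [in RHS](divn_eq a l) natrD natrM l0 mulr0 add0r. Qed.

Lemma mevalD xs e f : meval xs (madd e f) = meval xs e * meval xs f.
Proof.
elim: xs e f => [|x xs IH] [|a e] [|b f] /=; rewrite ?mul1r ?mulr1 //.
by rewrite IH exprD; ring.
Qed.

Lemma seval_cat xs P Q : seval xs (P ++ Q) = seval xs P + seval xs Q.
Proof. by rewrite /seval big_cat. Qed.

Lemma seval_insert xs t P :
  seval xs (sinsert l t P) = t.1%:R * meval xs t.2 + seval xs P.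
Proof.
elim: P => [|u P IH] /=; first by rewrite /seval big_seq1 big_nil addr0.
case: eqP => [->|_]; rewrite /seval !big_cons /=.
  by rewrite natr_modl natrD mulrDl addrA.
by rewrite -/(seval xs _) IH addrCA.
Qed.

Lemma seval_norm xs P : seval xs (snorm l P) = seval xs P.
Proof.
elim: P => [|t P IH] //=; rewrite seval_insert IH.
by rewrite [in RHS]/seval big_cons.
Qed.

Lemma seval_mul xs P Q : seval xs (smul l P Q) = seval xs P * seval xs Q.
Proof.
rewrite /seval big_allpairs_dep mulr_suml; apply: eq_bigr => t _.
rewrite mulr_sumr; apply: eq_bigr => u _ /=.
by rewrite natr_modl mevalD natrM; ring.
Qed.

Lemma seval_muln xs P Q : seval xs (smuln l P Q) = seval xs P * seval xs Q.
Proof. by rewrite seval_norm seval_mul. Qed.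

Lemma seval_pow xs P k : seval xs (spow l P k) = seval xs P ^+ k.
Proof.
elim: k => [|k IH]; last by rewrite seval_muln IH exprS.
by rewrite /seval /= big_seq1 mul1r; case: xs.
Qed.

Lemma seval_lin (f : nat -> R) V c :
  seval [seq f r | r <- V] (slin V c) = \sum_(r <- V) (c r)%:R * f r.
Proof.
elim: V => [|r V IH] /=; first by rewrite /seval !big_nil.
rewrite /seval big_cons /= big_cons big_map /= -IH /seval expr1.
congr (_ + _); first by case: map => *; rewrite mulr1.
by apply: eq_bigr => t _; rewrite expr0 mul1r.
Qed.

Lemma seval0 xs P : all (fun t => l %| t.1)%N P -> seval xs P = 0.
Proof.
move=> /allP h; rewrite /seval big_seq big1 // => t /h /dvdnP[k ->].
by rewrite natrM l0 mulr0 mul0r.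
Qed.

Lemma seval_part xs V r P : seval xs P =
  seval xs (spart l V r P) + \sum_(t <- P | mres V t.2 != r %[mod l]) t.1%:R * meval xs t.2.
Proof. by rewrite /seval big_filter [LHS](bigID (fun t => mres V t.2 == r %[mod l])). Qed.

End SparseEval.

(** * Residue parts of Jacobi's series *)

Section Residues.
Local Open Scope ring_scope.
Variables (l : nat) (l_prime : prime l) (d : nat) (V : seq nat).
Hypothesis V_uniq : uniq V.
Hypothesis V_tri :
  forall n, ('C(n.+1, 2) %% l \notin V)%N -> (l %| n.*2.+1)%N.

Let N := d.+1.
Local Notation tser := {poly %/ ('X^(d.+1) : {poly 'F_l})}.
Local Notation tq := (tq l d).
Local Notation P := (gser l d p).
Let l0 : l%:R = 0 :> tser := tser_l0 l_prime d.

(** The part [J_r] of Jacobi's series. By [V_tri] the classes outside [V] carry only coefficients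
    divisible by [l]. *)
Definition jpart (r : nat) : tser :=
  \sum_(n < N.*2.+1 | ('C(n.+1, 2) %% l == r)%N)
    (-1) ^+ n * (n.*2.+1%:R * tq ^+ 'C(n.+1, 2)).

Definition jparts : seq tser := [seq jpart r | r <- V].

Lemma graded_jpart r : graded r (jpart r).
Proof.
apply: graded_sum => n /eqP <-; apply: graded_sign; apply: graded_nat.
apply: (@graded_mod _ _ 'C(n.+1, 2)); first by rewrite modn_mod.
exact: graded_tqX.
Qed.

Lemma graded_meval e : graded (mres V e) (meval jparts e).
Proof.
rewrite /jparts; elim: V e => [|r V' IH] [|a e] /=; try exact: graded1.
by apply: (gradedM _ (IH e)); apply: gradedX; exact: graded_jpart.
Qed.

Lemma graded_seval_part r Q : graded r (seval jparts (spart l V r Q)).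
Proof.
rewrite /seval big_filter; apply: graded_sum => t /eqP e; apply: graded_nat.
by apply: (@graded_mod _ _ (mres V t.2)) => //; exact: graded_meval.
Qed.

Lemma avoids_rest r (Q : spoly) : avoids r
  (\sum_(t <- Q | mres V t.2 != r %[mod l]) t.1%:R * meval jparts t.2).
Proof.
apply: avoids_sum => t h; apply: (@avoids_graded _ _ _ (mres V t.2)).
  by rewrite eq_sym.
by apply: graded_nat; exact: graded_meval.
Qed.

Lemma seval_part0 r Q :
  avoids r (seval jparts Q) -> seval jparts (spart l V r Q) = 0.
Proof.
move=> aQ; apply: (@graded_avoids0 _ _ r); first exact: graded_seval_part.
move=> i iN ir; have := aQ i iN ir.
by rewrite (seval_part l _ V r) tcoefD avoids_rest // addr0.
Qed.

Lemma avoids_seval r Q :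
  seval jparts (spart l V r Q) = 0 -> avoids r (seval jparts Q).
Proof. by move=> e; rewrite (seval_part l _ V r) e add0r; exact: avoids_rest. Qed.

Lemma theta_moment_jparts k (c : nat -> nat) :
  (forall n, cpsum tser k n = n.*2.+1%:R * (c ('C(n.+1, 2) %% l)%N)%:R) ->
  theta_moment tq N k = seval jparts (slin V c).
Proof.
move=> hc; rewrite seval_lin.
under [RHS]eq_bigr do rewrite /jpart mulr_sumr big_mkcond /=.
rewrite exchange_big; apply: eq_bigr => n _; rewrite -/(cpsum tser k n) hc.
have [hV|hV] := boolP ('C(n.+1, 2) %% l \in V)%N.
  rewrite (bigD1_seq _ hV V_uniq) /= eqxx big1 ?addr0 => [|r rV].
    by ring.
  by rewrite eq_sym (negPf rV).
have /dvdnP[a ->] := V_tri hV.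
rewrite natrM l0 mulr0 mul0r mulr0 big1 // => r _.
by case: ifP => // _; rewrite !(mulr0, mul0r).
Qed.

(** As [t_0 = E^3] and [P = 1 / E], the product [t_0^a S_m P^(b l)] is [S_m P]; the factor [P^(b l)]
    is a series in [q^l] and does not mix classes. *)
Lemma dvdn_M m a b r : odd l -> odd m -> (3 * a + 1 = b * l)%N ->
  avoids r (theta_moment tq N 0 ^+ a * lambert_moment tq N m) ->
  forall i, (i < N)%N -> i = r %[mod l] -> (l %| M m i)%N.
Proof.
move=> l_odd m_odd ab av i iN ir.
have PE : qpoch tq N * P = 1 by exact: gser_p.
have key : theta_moment tq N 0 ^+ a * lambert_moment tq N m * (P ^+ b) ^+ l =
    - gser l d (M m) *+ 2.
  rewrite lambert_moment_odd // (theta_moment0 (tqN _ _)) gser_M //.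
  rewrite -!exprM -ab exprD expr1.
  transitivity (- S_series tq N m *+ 2 * P * (qpoch tq N * P) ^+ (3 * a)).
    by rewrite exprMn; ring.
  by rewrite PE expr1n; ring.
have := avoidsM av (graded_Frobenius l_prime (P ^+ b)) iN ir.
rewrite key mulr2n tcoefD tcoefN tcoef_gser // -mulr2n mulNrn.
(* The factor 2 from [lambert_moment_odd] is prime to the odd [l]. *)
move/eqP; rewrite oppr_eq0 -mulrnA natr_Fl_eq0 // Euclid_dvdM //.
by move=> /orP[|]; rewrite ?(@dvdn_prime2 l 2) // => /eqP e; rewrite e in l_odd.
Qed.

Local Notation t := (theta_moment tq N).
Local Notation w := (lambert_moment tq N).

Lemma theta_moment2 : t 2 = t 0 * w 1.
Proof.
rewrite theta_momentS ?tqN // !big_ord_recr big_ord0 /=.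
rewrite (@lambert_moment_even _ tq N 0) //.
(* Conversion evaluates the binomial coefficients and indices before [ring] is called; the even
   Lambert moments are already 0. *)
rewrite -[LHS]/(0 + 1%:R * (0 * t 1) + 1%:R * (w 1 * t 0)).
by ring.
Qed.

Lemma theta_moment4 : t 4 = t 0 * w 3 + 3 * t 2 * w 1.
Proof.
rewrite theta_momentS ?tqN // !big_ord_recr big_ord0 /=.
rewrite (@lambert_moment_even _ tq N 0) //.
rewrite (@lambert_moment_even _ tq N 2) //.
rewrite -[LHS]/(0 + 1%:R * (0 * t 3) + 3%:R * (w 1 * t 2)
 + 3%:R * (0 * t 1) + 1%:R * (w 3 * t 0)).
by ring.
Qed.

Lemma theta_moment6 : t 6 = t 0 * w 5 + 10 * t 2 * w 3 + 5 * t 4 * w 1.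
Proof.
rewrite theta_momentS ?tqN // !big_ord_recr big_ord0 /=.
rewrite (@lambert_moment_even _ tq N 0) //.
rewrite (@lambert_moment_even _ tq N 2) //.
rewrite (@lambert_moment_even _ tq N 4) //.
rewrite -[LHS]/(0 + 1%:R * (0 * t 5) + 5%:R * (w 1 * t 4)
 + 10%:R * (0 * t 3) + 10%:R * (w 3 * t 2) + 5%:R * (0 * t 1)
 + 1%:R * (w 5 * t 0)).
by ring.
Qed.

Lemma theta_moment8 : t 8 =
  t 0 * w 7 + 21 * t 2 * w 5 + 35 * t 4 * w 3 + 7 * t 6 * w 1.
Proof.
rewrite theta_momentS ?tqN // !big_ord_recr big_ord0 /=.
rewrite (@lambert_moment_even _ tq N 0) //.
rewrite (@lambert_moment_even _ tq N 2) //.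
rewrite (@lambert_moment_even _ tq N 4) //.
rewrite (@lambert_moment_even _ tq N 6) //.
rewrite -[LHS]/(0 + 1%:R * (0 * t 7) + 7%:R * (w 1 * t 6)
 + 21%:R * (0 * t 5) + 35%:R * (w 3 * t 4) + 35%:R * (0 * t 3)
 + 21%:R * (w 5 * t 2) + 7%:R * (0 * t 1) + 1%:R * (w 7 * t 0)).
by ring.
Qed.

End Residues.

(** Represents [- k P]: coefficients are naturals, so [l.-1] stands for -1. *)
Definition sneg (l k : nat) (P : spoly) : spoly :=
  smul l [:: ((l.-1 * k) %% l, [::])] P.

(** * Lambert moments as forms in the residue parts *)

Section LambertPolys.
Variables (l : nat) (V : seq nat) (c : nat -> nat -> nat).

Let T (k : nat) : spoly := slin V (c k).

(* [lpolym] represents [t_0 ^ k * w_m] with [m = 2 k - 1]: solve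
   [theta_moment2], ..., [theta_moment8] for [w_m]. *)
Definition lpoly1 : spoly := T 2.
Definition lpoly3 : spoly :=
  snorm l (smuln l (T 0) (T 4) ++ sneg l 3 (smuln l (T 2) lpoly1)).
Definition lpoly5 : spoly :=
  snorm l (smuln l (smuln l (T 0) (T 0)) (T 6)
  ++ sneg l 10 (smuln l (T 2) lpoly3)
  ++ sneg l 5 (smuln l (smuln l (T 0) (T 4)) lpoly1)).
Definition lpoly7 : spoly :=
  snorm l (smuln l (smuln l (smuln l (T 0) (T 0)) (T 0)) (T 8)
  ++ sneg l 21 (smuln l (T 2) lpoly5)
  ++ sneg l 35 (smuln l (smuln l (T 0) (T 4)) lpoly3)
  ++ sneg l 7 (smuln l (smuln l (smuln l (T 0) (T 0)) (T 6)) lpoly1)).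

Section Eval.
Local Open Scope ring_scope.
Variables (l_prime : prime l) (d : nat).
Local Notation tser := {poly %/ ('X^(d.+1) : {poly 'F_l})}.
Local Notation js := (jparts l d V).
Local Notation t := (theta_moment (tq l d) d.+1).
Local Notation w := (lambert_moment (tq l d) d.+1).
Let l0 : l%:R = 0 :> tser := tser_l0 l_prime d.

Lemma seval_neg k P : seval js (sneg l k P) = - (k%:R * seval js P).
Proof.
rewrite seval_mul // -mulNr; congr (_ * _); rewrite /seval big_seq1.
have -> : meval js [::] = 1 by rewrite /jparts; case: V.
rewrite mulr1 natr_modl // natrM -mulN1r; congr (_ * _).
apply/eqP; rewrite -addr_eq0 natr1 prednK ?prime_gt0 //; exact/eqP.
Qed.

Lemma seval_lpoly1 : t 2 = seval js (T 2) -> seval js lpoly1 = t 0 * w 1.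
Proof. by move=> <-; rewrite theta_moment2. Qed.

Lemma seval_lpoly3 : t 0 = seval js (T 0) -> t 2 = seval js (T 2) ->
  t 4 = seval js (T 4) -> seval js lpoly3 = t 0 ^+ 2 * w 3.
Proof.
move=> h0 h2 h4; rewrite seval_norm // seval_cat seval_neg !seval_muln // seval_lpoly1 //.
by rewrite -h0 -?h2 -h4 theta_moment4 theta_moment2; ring.
Qed.

Lemma seval_lpoly5 : t 0 = seval js (T 0) -> t 2 = seval js (T 2) ->
  t 4 = seval js (T 4) -> t 6 = seval js (T 6) ->
  seval js lpoly5 = t 0 ^+ 3 * w 5.
Proof.
move=> h0 h2 h4 h6; rewrite seval_norm // 2!seval_cat !seval_neg !seval_muln //.
rewrite seval_lpoly3 // seval_lpoly1 //.
by rewrite -h0 -?h2 -h4 -h6 theta_moment6 theta_moment2; ring.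
Qed.

Lemma seval_lpoly7 : t 0 = seval js (T 0) -> t 2 = seval js (T 2) ->
  t 4 = seval js (T 4) -> t 6 = seval js (T 6) -> t 8 = seval js (T 8) ->
  seval js lpoly7 = t 0 ^+ 4 * w 7.
Proof.
move=> h0 h2 h4 h6 h8; rewrite seval_norm // 3!seval_cat !seval_neg !seval_muln //.
rewrite seval_lpoly5 // seval_lpoly3 // seval_lpoly1 //.
by rewrite -h0 -?h2 -h4 -h6 -h8 theta_moment8 theta_moment2; ring.
Qed.

End Eval.
End LambertPolys.

(** * Certificates and the congruences modulo 5, 7 and 11 *)

(* [cert] lists terms [(a, e, k)]: adding [a x^e] times the relation [rels k] for
   every one of them kills the residue [r] part of [X] modulo [l]. *)
Definition cert_ok (l : nat) (V : seq nat) (r : nat) (X : spoly)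
    (rels : nat -> spoly) (cert : seq (nat * seq nat * nat)) : bool :=
  all (fun t => l %| t.1) (snorm l (spart l V r X
    ++ flatten [seq smul l [:: u.1] (rels u.2) | u <- cert])).

Lemma cert_okP l V r X rels cert (l_prime : prime l) d :
  cert_ok l V r X rels cert ->
  (forall u, u \in cert -> seval (jparts l d V) (rels u.2) = 0%R) ->
  avoids r (seval (jparts l d V) X).
Proof.
move=> ok hrel; apply: avoids_seval; have l0 := tser_l0 l_prime d.
have := seval0 l0 (jparts l d V) ok; rewrite seval_norm // seval_cat => e.

suff s0 : seval (jparts l d V) (flatten [seq smul l [:: u.1] (rels u.2) | u <- cert]) = 0%R.
  by rewrite s0 addr0 in e.
elim: cert {ok e} hrel => [|u cert IH] hrel; first by rewrite /seval big_nil.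
rewrite /= seval_cat seval_mul // hrel ?mem_head // mulr0 add0r.
by apply: IH => v vc; apply: hrel; rewrite inE vc orbT.
Qed.

Lemma eq_modn_mul l x y a b : x + l * a = y + l * b -> x = y %[mod l].
Proof. by move=> h; rewrite -(modnMDl a) -[RHS](modnMDl b) !(mulnC _ l) addnC h addnC. Qed.

Lemma modn_quad l a b n :
  a * n * n + b * n = a * (n %% l) * (n %% l) + b * (n %% l) %[mod l].
Proof.
have e := divn_eq n l; set k := n %/ l in e; set r := n %% l in e *.
apply: (@eq_modn_mul _ _ _ 0 (a * k * (k * l + r) + a * r * k + b * k)).
by rewrite e; ring.
Qed.

(* Cofactors found by linear algebra over F_11. *)
Definition cert11_1_6 : seq (nat * seq nat * nat) :=
  [:: (10, [:: 0; 0; 0; 0; 3], 9); (4, [:: 0; 0; 0; 2; 1], 6);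
      (10, [:: 0; 0; 0; 3], 10); (10, [:: 0; 0; 1; 1; 1], 9);
      (10, [:: 0; 0; 3], 8); (10, [:: 0; 1; 1; 0; 1], 3);
      (4, [:: 0; 1; 2], 10); (4, [:: 0; 2; 0; 1], 9); (10, [:: 0; 3], 3);
      (4, [:: 1; 0; 0; 0; 2], 8); (10, [:: 1; 0; 1; 1], 8);
      (10, [:: 1; 1; 0; 0; 1], 6); (10, [:: 1; 1; 0; 1], 10);
      (4, [:: 2; 0; 1], 3); (10, [:: 3], 6)].

Definition cert11_3_0 : seq (nat * seq nat * nat) :=
  [:: (1, [:: 0; 0; 0; 0; 3], 3); (3, [:: 0; 0; 1; 1; 1], 3);
      (2, [:: 0; 0; 2; 0; 1], 6); (7, [:: 0; 0; 2; 1], 10);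
      (4, [:: 0; 1; 1; 0; 1], 8); (2, [:: 0; 2; 0; 0; 1], 10);
      (1, [:: 0; 2; 0; 1], 3); (10, [:: 0; 3], 8); (3, [:: 1; 0; 0; 1; 1], 6);
      (5, [:: 1; 0; 0; 2], 10); (5, [:: 2; 1], 10)].

Definition cert11_3_6 : seq (nat * seq nat * nat) :=
  [:: (2, [:: 0; 0; 0; 0; 3], 9); (3, [:: 0; 0; 0; 2; 1], 6);
      (3, [:: 0; 0; 0; 3], 10); (7, [:: 0; 0; 1; 1; 1], 9);
      (1, [:: 0; 1; 1; 0; 1], 3); (1, [:: 0; 1; 2], 10);
      (10, [:: 0; 2; 0; 1], 9); (8, [:: 0; 3], 3); (6, [:: 1; 0; 0; 0; 2], 8);
      (9, [:: 1; 0; 1; 1], 8); (5, [:: 1; 1; 0; 0; 1], 6);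
      (6, [:: 1; 1; 0; 1], 10); (4, [:: 3], 6)].

Definition cert11_7_6 : seq (nat * seq nat * nat) :=
  [:: (3, [:: 0; 0; 0; 0; 3], 9); (9, [:: 0; 0; 0; 2; 1], 6);
      (10, [:: 0; 0; 0; 3], 10); (9, [:: 0; 0; 1; 1; 1], 9);
      (6, [:: 0; 0; 3], 8); (8, [:: 0; 1; 1; 0; 1], 3);
      (10, [:: 0; 1; 2], 10); (1, [:: 0; 2; 0; 1], 9); (9, [:: 0; 3], 3);
      (8, [:: 1; 0; 0; 0; 2], 8); (3, [:: 1; 0; 1; 1], 8);
      (10, [:: 1; 1; 0; 0; 1], 6); (6, [:: 1; 1; 0; 1], 10);
      (4, [:: 2; 0; 1], 3); (8, [:: 3], 6)].

Lemma double_bin2S n : 2 * 'C(n.+1, 2) = n * n.+1.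
Proof. by elim: n => // n IH; rewrite binS bin1 mulnDr IH; ring. Qed.

Lemma double_bin2 n : 2 * 'C(n, 2) + n = n * n.
Proof. by case: n => // n; rewrite double_bin2S; ring. Qed.

(* [g.+1] inverts 2 modulo [l = 2 g + 1]. *)
Lemma triangular_mod l g n : l = g.*2.+1 ->
  'C(n.+1, 2) %% l = (g.+1 * (n %% l) * (n %% l) + g.+1 * (n %% l)) %% l.
Proof.
move=> lE; rewrite -modn_quad; apply: (@eq_modn_mul _ _ _ 'C(n.+1, 2) 0).
transitivity (g.+1 * (2 * 'C(n.+1, 2))); first by rewrite lE -muln2; ring.
by rewrite double_bin2S; ring.
Qed.

Lemma triangular_residues l g (V : seq nat) : l = g.*2.+1 ->
  all (fun b => ((g.+1 * b * b + g.+1 * b) %% l \in V) || (l %| b.*2.+1)) (iota 0 l) ->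
  forall n, 'C(n.+1, 2) %% l \notin V -> l %| n.*2.+1.
Proof.
move=> lE /allP ok n; have l0 : 0 < l by rewrite lE.
have /ok : n %% l \in iota 0 l by rewrite mem_iota ltn_mod.
rewrite -triangular_mod // => /orP[->//|h0 _].
have -> : n.*2.+1 = n %/ l * 2 * l + (n %% l).*2.+1 by have := divn_eq n l; lia.
by rewrite dvdn_addr ?dvdn_mull.
Qed.

(** Modulo [l], [g.+1] and [g] are 1/2 and -1/2, so the tested values are the pentagonal numbers
    [(3 b^2 - b) / 2] and [(3 b^2 + b) / 2]. *)
Lemma pentagonal_residues l g r : l = g.*2.+1 ->
  all (fun b => (g.+1 * 3 * b * b + g * b != r %[mod l]) &&
                (g.+1 * 3 * b * b + g.+1 * b != r %[mod l])) (iota 0 l) ->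
  forall j, (3 * 'C(j, 2) + j != r %[mod l]) /\ (3 * 'C(j, 2) + 2 * j != r %[mod l]).
Proof.
move=> lE /allP ok j; have l0 : 0 < l by rewrite lE.
have /ok : j %% l \in iota 0 l by rewrite mem_iota ltn_mod.
rewrite -!modn_quad => /andP[h1 h2]; have e := double_bin2 j.
have {}e : g.+1 * 3 * j * j = g.+1 * 3 * (2 * 'C(j, 2) + j) by rewrite e; ring.
split.
  rewrite (@eq_modn_mul l _ (g.+1 * 3 * j * j + g * j) (3 * 'C(j, 2) + j + j) 0) //.
  by rewrite e lE -muln2; ring.
rewrite (@eq_modn_mul l _ (g.+1 * 3 * j * j + g.+1 * j) (3 * 'C(j, 2) + 2 * j) 0) //.
by rewrite e lE -muln2; ring.
Qed.


(* [tri]l lists the residues modulo [l] of the triangular numbers [n(n+1)/2] with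
   [l] not dividing [2 n + 1]; [weight]l [k] is the value modulo [l] of
   [(sum_{|a| <= n} a^k) / (2 n + 1)] as a function of [n(n+1)/2]. *)
Definition tri5 := [:: 0; 1].
Definition weight5 (k r : nat) : nat := if k is 2 then 4 * r else 1.
Definition tri7 := [:: 0; 1; 3].
Definition weight7 (k r : nat) : nat :=
  match k with 2 => 10 * r | 4 => 2 * r * (6 * r + 6) | _ => 1 end.
Definition tri11 := [:: 0; 1; 3; 6; 10].
Definition weight11 (k r : nat) : nat :=
  match k with
  | 2 => 8 * r
  | 4 => (6 * r + 10) %% 11 * (6 * r)
  | 6 => ((r + 5) %% 11 * r + 1) %% 11 * (9 * r)
  | 8 => (((7 * r + 4) %% 11 * r + 7) %% 11 * r + 8) %% 11 * (2 * r)
  | _ => 1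
  end.

Section CongruenceWeights.
Local Open Scope ring_scope.

Lemma tri_natr (R : comNzRingType) n : n%:R * n.+1%:R = 2 * 'C(n.+1, 2)%:R :> R.
Proof. by rewrite -!natrM double_bin2S. Qed.

Section Weights11.
Variable R : comNzRingType.
Hypothesis l0 : 11%:R = 0 :> R.

(** The constants 4, 3, 10 and 1 invert the denominators 3, 15, 21 and 45 modulo 11. *)
Lemma cpsum_weight11 k n : k \in [:: 0; 2; 4; 6; 8]%N ->
  cpsum R k n = n.*2.+1%:R * (weight11 k ('C(n.+1, 2) %% 11)%N)%:R.
Proof.
have tE := natr_modl l0 'C(n.+1, 2).
have X := tri_natr R n; set T := ('C(n.+1, 2) %% 11)%N in tE *.
rewrite -tE in X; rewrite !inE => /or4P[|||/orP[]] /eqP-> /=.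
- by rewrite cpsum0 mulr1.
- have -> : cpsum R 2 n = 4 * (3 * cpsum R 2 n) - 11%:R * cpsum R 2 n by ring.
  by rewrite cpsum2 l0 mul0r X; ring.
- have -> : cpsum R 4 n = 3 * (15 * cpsum R 4 n) - 11%:R * (4 * cpsum R 4 n) by ring.
  rewrite cpsum4 X natrM natr_modl //.
  transitivity (n.*2.+1%:R * (6 * T%:R * (6 * T%:R - 1))
     + 11%:R * (6 * T%:R * n.*2.+1%:R) : R); last by ring.
  by rewrite l0; ring.
- have -> : cpsum R 6 n = 10 * (21 * cpsum R 6 n) - 11%:R * (19 * cpsum R 6 n) by ring.
  rewrite cpsum6 X natrM natr_modl // natrD natrM natr_modl //.
  transitivity (n.*2.+1%:R * (20 * T%:R * (12 * T%:R ^+ 2 - 6 * T%:R + 1))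
     + 11%:R * ((- 21 * T%:R ^+ 3 + 15 * T%:R ^+ 2 - T%:R) * n.*2.+1%:R) : R);
     last by ring.
  by rewrite l0; ring.
- have -> : cpsum R 8 n = 45 * cpsum R 8 n - 11%:R * (4 * cpsum R 8 n) by ring.
  rewrite cpsum8 X natrM natr_modl // natrD natrM natr_modl //.
  rewrite natrD natrM natr_modl //.
  transitivity (n.*2.+1%:R * (2 * T%:R * (40 * T%:R ^+ 3 - 40 * T%:R ^+ 2 + 18 * T%:R - 3))
     + 11%:R * (2 * T%:R * (- 3 * T%:R ^+ 3 + 4 * T%:R ^+ 2 - T%:R + 1)
          * n.*2.+1%:R) : R); last by ring.
  by rewrite l0; ring.
Qed.
End Weights11.

Lemma cpsum_weight7 (R : comNzRingType) k n : 7%:R = 0 :> R -> k \in [:: 0; 2; 4]%N ->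
  cpsum R k n = n.*2.+1%:R * (weight7 k ('C(n.+1, 2) %% 7)%N)%:R.
Proof.
move=> l0; have tE := natr_modl l0 'C(n.+1, 2).
have X := tri_natr R n; set T := ('C(n.+1, 2) %% 7)%N in tE *.
rewrite -tE in X; rewrite !inE => /or3P[] /eqP-> /=.
- by rewrite cpsum0 mulr1.
- have -> : cpsum R 2 n = 5 * (3 * cpsum R 2 n) - 7%:R * (2 * cpsum R 2 n) by ring.
  by rewrite cpsum2 l0 mul0r X; ring.
- have -> : cpsum R 4 n = 15 * cpsum R 4 n - 7%:R * (2 * cpsum R 4 n) by ring.
  rewrite cpsum4 X.
  transitivity (n.*2.+1%:R * (2 * T%:R * (6 * T%:R - 1)) + 7%:R * (2 * T%:R * n.*2.+1%:R) : R).
    by rewrite l0; ring.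
  by ring.
Qed.

Lemma cpsum_weight5 (R : comNzRingType) k n : 5%:R = 0 :> R -> k \in [:: 0; 2]%N ->
  cpsum R k n = n.*2.+1%:R * (weight5 k ('C(n.+1, 2) %% 5)%N)%:R.
Proof.
move=> l0; have tE := natr_modl l0 'C(n.+1, 2).
have X := tri_natr R n; set T := ('C(n.+1, 2) %% 5)%N in tE *.
rewrite -tE in X; rewrite !inE => /orP[] /eqP-> /=.
- by rewrite cpsum0 mulr1.
- have -> : cpsum R 2 n = 2 * (3 * cpsum R 2 n) - 5%:R * cpsum R 2 n by ring.
  by rewrite cpsum2 l0 mul0r X; ring.
Qed.

End CongruenceWeights.

(** A quartic form, meant for the five classes modulo 11 that contain no pentagonal number. *)
Definition rel11 (k : nat) : spoly :=
  spart 11 tri11 k (spow 11 (slin tri11 (weight11 0)) 4).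

Section Congruences.
Local Open Scope ring_scope.

Lemma theta_moment_mod11 d k : k \in [:: 0; 2; 4; 6; 8]%N ->
  theta_moment (tq 11 d) d.+1 k = seval (jparts 11 d tri11) (slin tri11 (weight11 k)).
Proof.
move=> hk; apply: theta_moment_jparts => //.
  exact: (@triangular_residues 11 5).
by move=> n; apply: cpsum_weight11 => //; exact: tser_l0.
Qed.

Lemma theta_moment_mod7 d k : k \in [:: 0; 2; 4]%N ->
  theta_moment (tq 7 d) d.+1 k = seval (jparts 7 d tri7) (slin tri7 (weight7 k)).
Proof.
move=> hk; apply: theta_moment_jparts => //.
  exact: (@triangular_residues 7 3).
by move=> n; apply: cpsum_weight7 => //; exact: tser_l0.
Qed.

Lemma theta_moment_mod5 d k : k \in [:: 0; 2]%N ->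
  theta_moment (tq 5 d) d.+1 k = seval (jparts 5 d tri5) (slin tri5 (weight5 k)).
Proof.
move=> hk; apply: theta_moment_jparts => //.
  exact: (@triangular_residues 5 2).
by move=> n; apply: cpsum_weight5 => //; exact: tser_l0.
Qed.

(* [J^4 = E^12 = E * E^11] has only the residues of the pentagonal numbers. *)
Lemma seval_rel11 d k : k \in [:: 3; 6; 8; 9; 10]%N ->
  seval (jparts 11 d tri11) (rel11 k) = 0.
Proof.
move=> hk; apply: seval_part0; rewrite seval_pow; last exact: tser_l0.
rewrite -theta_moment_mod11 // theta_moment0 ?tqN // -exprM.
rewrite -[(3 * 4)%N]/(11.+1) exprS; apply: avoidsM; last exact: graded_Frobenius.
apply: pentagonal_avoids; apply: (@pentagonal_residues 11 5) => //.
by move: hk; rewrite !inE => /or4P[|||/orP[]] /eqP->.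
Qed.

Lemma dvdn_M_cert l V a b m r X rels cert n : prime l -> odd l -> odd m ->
  (3 * a + 1 = b * l)%N ->
  (forall d, seval (jparts l d V) X =
     theta_moment (tq l d) d.+1 0 ^+ a * lambert_moment (tq l d) d.+1 m) ->
  (forall d u, u \in cert -> seval (jparts l d V) (rels u.2) = 0) ->
  cert_ok l V r X rels cert ->
  n = r %[mod l] -> (l %| M m n)%N.
Proof.
(* Truncation at [q^(n+1)] still shows the coefficient of [q^n]. *)
move=> lp lo mo ab hX hr ok nr; apply: (dvdn_M lp lo mo ab _ (leqnn n.+1) nr).
by rewrite -hX; apply: cert_okP ok (hr n).
Qed.

End Congruences.

(** These three represent [t_0^7 w_m], with 7 from [3 * 7 + 1 = 2 * 11]; the Lambert polynomials
    already contain 1, 2 and 4 factors [t_0]. *)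
Definition X11_1 := smul 11 (lpoly1 tri11 weight11) (spow 11 (slin tri11 (weight11 0)) 6).
Definition X11_3 := smul 11 (lpoly3 11 tri11 weight11) (spow 11 (slin tri11 (weight11 0)) 5).
Definition X11_7 := smul 11 (lpoly7 11 tri11 weight11) (spow 11 (slin tri11 (weight11 0)) 3).

Lemma cert11_1_6_ok : cert_ok 11 tri11 6 X11_1 rel11 cert11_1_6.
Proof. by vm_compute. Qed.

Lemma cert11_3_ok r : r \in [:: 0; 6] ->
  cert_ok 11 tri11 r X11_3 rel11 (if r == 0 then cert11_3_0 else cert11_3_6).
Proof. by rewrite !inE => /orP[] /eqP->; vm_compute. Qed.

Lemma cert11_7_6_ok : cert_ok 11 tri11 6 X11_7 rel11 cert11_7_6.
Proof. by vm_compute. Qed.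

(** Three residues from 0 and 1 never add up to 4 modulo 5, so the empty certificate suffices. *)
Lemma M1_mod5 n : n = 4 %[mod 5] -> 5 %| M 1 n.
Proof.
apply: (@dvdn_M_cert 5 tri5 3 2 1 4
  (smul 5 (lpoly1 tri5 weight5) (spow 5 (slin tri5 (weight5 0)) 2)) (fun=> [::]) [::]) => //.
move=> d; have l0 := tser_l0 (isT : prime 5) d.
rewrite seval_mul // seval_pow // -theta_moment_mod5 //.
rewrite seval_lpoly1 ?theta_moment_mod5 //.
by ring.
Qed.

Lemma M1_mod7 n : n = 5 %[mod 7] -> 7 %| M 1 n.
Proof.
apply: (@dvdn_M_cert 7 tri7 2 1 1 5
  (smul 7 (lpoly1 tri7 weight7) (slin tri7 (weight7 0))) (fun=> [::]) [::]) => //.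
move=> d; have l0 := tser_l0 (isT : prime 7) d.
rewrite seval_mul // -theta_moment_mod7 // seval_lpoly1 ?theta_moment_mod7 //.
by ring.
Qed.

(** Two residues from 0, 1, 3 never add up to 5 modulo 7, and give 0 only as 0 + 0, where the
    weights of index 2 and 4 vanish. *)
Lemma M3_mod7 r n : r \in [:: 0; 5] -> n = r %[mod 7] -> 7 %| M 3 n.
Proof.
move=> hr; apply: (@dvdn_M_cert 7 tri7 2 1 3 r (lpoly3 7 tri7 weight7) (fun=> [::]) [::]) => //.
  by move=> d; rewrite seval_lpoly3 // theta_moment_mod7.
by move: hr; rewrite !inE => /orP[] /eqP->; vm_compute.
Qed.

Lemma M1_mod11 n : n = 6 %[mod 11] -> 11 %| M 1 n.
Proof.
apply: (dvdn_M_cert (a := 7) (b := 2) _ _ _ _ _ _ cert11_1_6_ok) => //.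
- move=> d; have l0 := tser_l0 (isT : prime 11) d.
  rewrite seval_mul // seval_pow // -theta_moment_mod11 //.
  rewrite seval_lpoly1 ?theta_moment_mod11 //.
  by ring.
- by move=> d u uc; apply: seval_rel11; move: u uc; apply/allP.
Qed.

Lemma M3_mod11 r n : r \in [:: 0; 6] -> n = r %[mod 11] -> 11 %| M 3 n.
Proof.
move=> hr.
apply: (dvdn_M_cert (a := 7) (b := 2) _ _ _ _ _ _ (cert11_3_ok hr)) => //.
- move=> d; have l0 := tser_l0 (isT : prime 11) d.
  rewrite seval_mul // seval_pow // -theta_moment_mod11 //.
  rewrite seval_lpoly3 ?theta_moment_mod11 //.
  by ring.
- by move=> d u uc; apply: seval_rel11; move: u uc; apply/allP; case: ifP.
Qed.

Lemma M7_mod11 n : n = 6 %[mod 11] -> 11 %| M 7 n.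
Proof.
apply: (dvdn_M_cert (a := 7) (b := 2) _ _ _ _ _ _ cert11_7_6_ok) => //.
- move=> d; have l0 := tser_l0 (isT : prime 11) d.
  rewrite seval_mul // seval_pow // -theta_moment_mod11 //.
  rewrite seval_lpoly7 ?theta_moment_mod11 //.
  by ring.
- by move=> d u uc; apply: seval_rel11; move: u uc; apply/allP.
Qed.

(** * Fermat lifts and the finite search *)

(** Fermat's theorem as [k^l = k] also covers multiples of [l]; it needs a positive exponent to
    absorb one factor [k]. *)
Lemma expn_modn_order l k m n : prime l -> 0 < m -> 0 < n ->
  m = n %[mod l - 1] -> k ^ m = k ^ n %[mod l].
Proof.
move=> lp; have l1 := prime_gt1 lp.
wlog mn : m n / m <= n.
  move=> h m0 n0 e; have [mn|nm] := leqP m n; first exact: h.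
  by symmetry; apply: h => //; exact: ltnW.
move=> m0 _ /eqP; rewrite eq_sym eqn_mod_dvd // => /dvdnP[q nE].
rewrite -(subnKC mn) nE; elim: q {n mn nE} => [|q IH]; first by rewrite addn0.
rewrite [LHS]IH.
have -> : m + q.+1 * (l - 1) = (m + q * (l - 1)).-1 + l.
  by rewrite mulSn; move: (q * (l - 1)) => X; lia.
by rewrite [in RHS]expnD -[RHS]modnMmr fermat_little // modnMmr -expnSr prednK //
  addn_gt0 m0.
Qed.

Lemma M_modn_order l m mb n : prime l -> 0 < m -> 0 < mb ->
  m = mb %[mod l - 1] -> M m n = M mb n %[mod l].
Proof.
move=> lp m0 mb0 e; rewrite /M.
apply: (big_ind2 (fun x y => x = y %[mod l])) => // [x1 x2 y1 y2 h1 h2|k _].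
  by rewrite -modnDm h1 h2 modnDm.
by rewrite -modnMml (expn_modn_order k lp m0 mb0 e) modnMml.
Qed.

Lemma fermat_liftP l m : odd m -> prime l -> 5 <= l ->
  fermat_lift l m (m %% (l - 1)).
Proof.
move=> mo lp l5; have lo : odd l by case: (even_prime lp) l5 => [->|].

(* Reduction modulo the even number [l - 1] keeps the exponent odd, hence nonzero. *)
have eo : odd (l - 1) = false by rewrite oddB ?lo //; lia.
have mbo : odd (m %% (l - 1)) by rewrite odd_mod.
have lt : m %% (l - 1) < l - 1 by rewrite ltn_mod; lia.
split=> //; first by move: mbo lt; case: (m %% _) => // a; lia.
- by rewrite modn_mod.
- move=> n; apply: M_modn_order => //; first by case: (m) mo.
    by case: (m %% _) mbo.
  by rewrite modn_mod.
Qed.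

(** * Tables of moments in binary arithmetic *)

Module NTable.
Import BinNat Nnat.
Local Notation "'nn' x" := (N.to_nat x) (at level 10).

Fixpoint dot (s t : seq N) : N :=
  match s, t with
  | a :: s', b :: t' => N.add (N.mul a b) (dot s' t')
  | _, _ => N0
  end.

Definition divs (B : nat) : seq (seq N) :=
  [seq [seq k <- [seq N.of_nat i | i <- iota 1 d]
         | N.eqb (N.modulo (N.of_nat d) k) N0] | d <- iota 1 B].

Definition sigs (m : nat) (ds : seq (seq N)) : seq N :=
  [seq foldr (fun k s => N.add (iter m (N.mul k) (Npos xH)) s) N0 ks | ks <- ds].

(* Returns [p B-1; ...; p 1; p 0], by [n p(n) = \sum_d sigma(d) p(n - d)]. *)
Fixpoint ptab (sg : seq N) (B : nat) : seq N :=
  match B with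
  | 0 => [::]
  | 1 => [:: Npos xH]
  | n.+1 => let acc := ptab sg n in N.div (dot sg acc) (N.of_nat n) :: acc
  end.

(** The partition numbers already read lie reversed in [acc], so [dot] is the convolution giving
    [M m] at the current index. *)
Fixpoint mtab (l : N) (sg acc ps : seq N) : seq N :=
  if ps is a :: ps' then
    N.modulo (dot sg acc) l :: mtab l sg (a :: acc) ps'
  else [::].

Definition test_exponents := [:: 1; 3; 5; 7; 9; 11; 13; 15; 17; 19; 21; 23; 25].
Definition test_primes := [:: 5; 7; 11; 13; 17; 19; 23; 29; 31; 37; 41; 43; 47; 53; 59; 61;
   67; 71; 73; 79; 83; 89; 97].
Definition nz (tab : seq N) (n : nat) : bool := ~~ N.eqb (nth N0 tab n) N0.

(** Outside the base list, one of the values at [r], [l + r], [2 l + r] must be nonzero modulo [l];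
    hence tables of length [3 l]. *)
Definition only_base_congruences (B : nat) : bool :=
  let ds := divs B in
  let ps := rev (ptab (sigs 1 ds) B) in
  let sgs := [seq (m, sigs m ds) | m <- test_exponents] in
  all (fun l =>
    let lN := N.of_nat l in
    let psl := [seq N.modulo a lN | a <- take (3 * l) ps] in
    all (fun msg =>
      let tab := mtab lN [seq N.modulo a lN | a <- take (3 * l) msg.2] [::] psl in
      all (fun r => [|| nz tab r, nz tab (l + r), nz tab (l * 2 + r) |
                        ((msg.1 %% (l - 1), l, r) \in base_congruences)])
        (iota 1 l.-1)) sgs) test_primes.

Lemma to_nat_mod a b : nn (N.modulo a b) = nn a %% nn b.
Proof.
have [->|b0] := N.eq_dec b N0; first by case: a => //= a; rewrite modn0.
have e := N.div_mod a b b0; have lt := N.mod_lt a b b0.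
have {}e : nn a = nn (N.div a b) * nn b + nn (N.modulo a b).
  rewrite {1}e N2Nat.inj_add N2Nat.inj_mul -[X in X = _]/(addn (muln _ _) _).
  by rewrite mulnC.
by rewrite e modnMDl modn_small //; lia.
Qed.

Lemma dotE s t : size t <= size s ->
  nn (dot s t) = \sum_(i < size t) nn (nth N0 s i) * nn (nth N0 t i).
Proof.
elim: s t => [|a s IH] [|b t] //= st; rewrite ?big_ord0 // big_ord_recl /=.
by rewrite N2Nat.inj_add N2Nat.inj_mul IH.
Qed.

Lemma sigs_spec m B i : i < B -> nn (nth N0 (sigs m (divs B)) i) = sigma m i.+1.
Proof.
move=> iB; rewrite (nth_map [::]) ?size_map ?size_iota //.
rewrite (nth_map 0) ?size_iota // nth_iota // add1n /sigma.
have E ks : nn (foldr (fun k s => N.add (iter m (N.mul k) (Npos xH)) s) N0 ks) =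
    \sum_(k <- [seq nn k | k <- ks]) k ^ m.
  elim: ks => [|k ks IH] /=; first by rewrite big_nil.
  rewrite big_cons N2Nat.inj_add IH; congr (_ + _).
  by elim: m {IH} => //= m' IH'; rewrite N2Nat.inj_mul IH' expnS.
rewrite E; apply: perm_big; apply: uniq_perm; last first.
- move=> k; rewrite -dvdn_divisors //; apply/mapP/idP.
    move=> [k']; rewrite mem_filter => /andP[/N.eqb_spec h _] ->.
    move/(congr1 N.to_nat): h; rewrite to_nat_mod Nat2N.id => h.
    exact/eqP.
  move=> kd; exists (N.of_nat k); last by rewrite Nat2N.id.
  rewrite mem_filter; apply/andP; split.
    by apply/N.eqb_spec/N2Nat.inj; rewrite to_nat_mod !Nat2N.id; apply/eqP.
  by apply: map_f; rewrite mem_iota (dvdn_gt0 _ kd) //= add1n ltnS dvdn_leq.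
- exact: divisors_uniq.
- rewrite map_inj_uniq; last exact: N2Nat.inj.
  by rewrite filter_uniq // map_inj_uniq ?iota_uniq //; exact: Nat2N.inj.
Qed.

Lemma M_ord m n : M m n = \sum_(i < n) sigma m i.+1 * p (n - i.+1).
Proof. by rewrite M_sigma big_add1 big_mkord. Qed.

Lemma size_ptab sg n : size (ptab sg n) = n.
Proof. by elim: n => // -[|n] //= IH; rewrite IH. Qed.

Lemma p0 : p 0 = 1.
Proof. by rewrite -(@pk_p 0) // pk0. Qed.

(** The division in [ptab] is exact because of [M1]. *)
Lemma ptab_spec B n i : n <= B.+1 -> i < n ->
  nn (nth N0 (ptab (sigs 1 (divs B)) n) i) = p (n - i.+1).
Proof.
elim: n i => // n IH i nB iN.
have [n0|n0] := posnP n.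
  by move: iN; rewrite n0 ltnS leqn0 => /eqP->; rewrite p0.
have -> : ptab (sigs 1 (divs B)) n.+1 =
  N.div (dot (sigs 1 (divs B)) (ptab (sigs 1 (divs B)) n)) (N.of_nat n)
    :: ptab (sigs 1 (divs B)) n by case: (n) n0.
case: i iN => [|i] iN /=; last by rewrite subSS IH //; lia.
have -> : dot (sigs 1 (divs B)) (ptab (sigs 1 (divs B)) n) =
    N.mul (N.of_nat (p n)) (N.of_nat n).
  apply: N2Nat.inj; rewrite dotE size_ptab ?size_map ?size_iota; last by lia.
  rewrite N2Nat.inj_mul !Nat2N.id -[RHS]/(p n * n) mulnC -M1 M_ord.
  apply: eq_bigr => j _; have := ltn_ord j => jn.
  by rewrite sigs_spec 1?IH //; lia.
by rewrite N.div_mul ?Nat2N.id ?subn1 //; lia.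
Qed.

Lemma nth_mtab l sg acc ps j : j < size ps ->
  nth N0 (mtab l sg acc ps) j = N.modulo (dot sg (rev (take j ps) ++ acc)) l.
Proof.
elim: ps acc j => // a ps IH acc [|j] jp //=.
by rewrite IH // rev_cons cat_rcons.
Qed.

Lemma nz_spec B m l n : 3 * l <= B -> n < 3 * l -> l > 0 ->
  let lN := N.of_nat l in
  nz (mtab lN [seq N.modulo a lN | a <- take (3 * l) (sigs m (divs B))] [::]
     [seq N.modulo a lN | a <- take (3 * l) (rev (ptab (sigs 1 (divs B)) B))]) n ->
  ~~ (l %| M m n).
Proof.
move=> lB nl l0 lN; rewrite /nz; set tab := mtab _ _ _ _; apply: contra => lM.
have sps : size (take (3 * l) (rev (ptab (sigs 1 (divs B)) B))) = 3 * l.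
  by rewrite size_takel // size_rev size_ptab.
have ssg : size (take (3 * l) (sigs m (divs B))) = 3 * l.
  by rewrite size_takel // !size_map size_iota.
apply/N.eqb_spec/N2Nat.inj; rewrite /tab nth_mtab ?size_map ?sps // cats0.
rewrite to_nat_mod Nat2N.id dotE; last first.
  by rewrite size_rev size_take !size_map sps ssg nl ltnW.
rewrite -[RHS](eqP lM) M_ord size_rev size_take size_map sps nl.
apply: (big_ind2 (fun x y => x = y %[mod l])) => // [x1 x2 y1 y2 h1 h2|i _].
  by rewrite -modnDm h1 h2 modnDm.
have lt := ltn_ord i.
rewrite -map_take -map_rev take_takel ?(ltnW nl) //.
have sn : size (take n (rev (ptab (sigs 1 (divs B)) B))) = n.
  by rewrite size_takel // size_rev size_ptab; lia.
rewrite !(nth_map N0) ?size_rev ?sn ?ssg //; last by lia.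
rewrite !to_nat_mod !Nat2N.id modnMm nth_rev sn // nth_take; last by lia.
rewrite sigs_spec; last by lia.
rewrite nth_take; last by lia.
rewrite nth_rev ?size_ptab; last by lia.
rewrite ptab_spec; [|lia|lia].
by congr (_ * p _ %% _); lia.
Qed.

Lemma only_base_congruencesP B : only_base_congruences B -> 291 <= B -> forall m l r,
  m \in test_exponents -> l \in test_primes -> 1 <= r < l ->
  (forall n, l %| M m (l * n + r)) -> (m %% (l - 1), l, r) \in base_congruences.
Proof.
move=> /allP ck B291 m l r hm hl /andP[r0 rl] h.
have /allP/(_ (m, sigs m (divs B))) := ck l hl.
have hmm : (m, sigs m (divs B)) \in [seq (m, sigs m (divs B)) | m <- test_exponents].
  exact: map_f.
move=> /(_ hmm) /allP /(_ r) /=.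
have l97 : l <= 97 by move: l hl {r0 rl h ck hmm}; apply/allP.
have -> : r \in iota 1 l.-1 by rewrite mem_iota r0 /=; lia.
move=> /(_ isT) /or4P[] //; move/nz_spec; move=> /(_ _ _ _) hh; exfalso.
- have := h 0; rewrite muln0 add0n; apply/negP/hh; lia.
- have := h 1; rewrite muln1; apply/negP/hh; lia.
- have := h 2; apply/negP/hh; lia.
Qed.

(** The bound is [3 * 97], for the largest prime tested. *)
Lemma only_base_congruences_291 : only_base_congruences 291.
Proof. by vm_compute. Qed.

End NTable.

Lemma dvdn_eq_mod0 l x : l %| x <-> x = 0 %[mod l].
Proof. by rewrite mod0n; split => /eqP. Qed.

Lemma eq_modn_add l n r : l * n + r = r %[mod l].
Proof. by rewrite mulnC modnMDl. Qed.

Lemma M_base mb l r n : (mb, l, r) \in base_congruences -> l %| M mb (l * n + r).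
Proof.
rewrite !inE => /or4P[| | |/or4P[| | |/orP[]]] /eqP[-> -> ->].
- exact/M1_mod5/eq_modn_add.
- exact/M1_mod7/eq_modn_add.
- exact/M1_mod11/eq_modn_add.
- exact/(@M3_mod7 0)/eq_modn_add.
- exact/(@M3_mod7 5)/eq_modn_add.
- exact/(@M3_mod11 0)/eq_modn_add.
- exact/(@M3_mod11 6)/eq_modn_add.
- exact/M7_mod11/eq_modn_add.
Qed.

Lemma M_lift_base m mb l r n : prime l -> odd m -> 0 < mb ->
  m = mb %[mod l - 1] -> (mb, l, r) \in base_congruences ->
  M m (l * n + r) = 0 %[mod l].
Proof.
move=> lp mo mb0 e hb; rewrite (M_modn_order _ lp _ mb0 e); last by case: m mo e.
exact/dvdn_eq_mod0/M_base.
Qed.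

Theorem theorem5p1 :
  (forall m n : nat, M m n = \sum_(1 <= d < n.+1) sigma m d * p (n - d))
  /\
  (* (i) *)
  (forall m l : nat, odd m -> prime l -> 5 <= l ->
     exists mb : nat,
       fermat_lift l m mb)
  /\
  (* (ii) *)
  ((forall l m : nat, prime l -> 5 <= l -> odd m -> m = 1 %[mod l - 1] ->
      forall n : nat, M m (l * n) = 0 %[mod l])
   /\
   (forall l : nat, prime l -> 5 <= l ->
      forall n : nat,
        M 1 (l * n) = l * n * p (l * n) /\ M 1 (l * n) = 0 %[mod l]))
  /\
  (* (iii) *)
  (forall m : nat, odd m ->
     [/\ m = 1 %[mod 4] -> forall n : nat, M m (5 * n + 4) = 0 %[mod 5],
         m = 1 %[mod 6] -> forall n : nat, M m (7 * n + 5) = 0 %[mod 7]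
       & m = 1 %[mod 10] -> forall n : nat, M m (11 * n + 6) = 0 %[mod 11]])
  /\
  (* (iv) *)
  (forall n : nat,
     [/\ M 3 (7 * n) = 0 %[mod 7],
         M 3 (7 * n + 5) = 0 %[mod 7],
         M 3 (11 * n) = 0 %[mod 11],
         M 3 (11 * n + 6) = 0 %[mod 11]
       & M 7 (11 * n + 6) = 0 %[mod 11]])
  /\
  (* (v) *)
  (forall m l r : nat,
     odd m -> 1 <= m <= 25 -> prime l -> 5 <= l <= 97 -> 1 <= r < l ->
     (forall n : nat, M m (l * n + r) = 0 %[mod l]) ->
     [/\ l \in [:: 5; 7; 11],
         (l, r) \in [:: (5, 4); (7, 5); (11, 6)]
       & exists mb : nat,
           [/\ mb \in [:: 1; 3; 7],
               fermat_lift l m mb,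
               (mb, l, r) \in base_congruences
             & forall n : nat, M mb (l * n + r) = 0 %[mod l]]]).
Proof.
have M1_mod l n : M 1 (l * n) = 0 %[mod l].
  by apply/dvdn_eq_mod0; rewrite M1 -mulnA dvdn_mulr.
split; first exact: M_sigma.
split; first by move=> m l mo lp l5; exists (m %% (l - 1)); exact: fermat_liftP.
split.
  split=> [l m lp l5 mo e n|l lp l5 n]; last by rewrite M1_mod M1.
  by rewrite (M_modn_order _ lp _ _ e) //; case: m mo e.
split.
  move=> m mo; split=> e n; first exact: (@M_lift_base _ 1).
  - exact: (@M_lift_base _ 1).
  - exact: (@M_lift_base _ 1).
split.
  move=> n; split; apply/dvdn_eq_mod0; try exact: M_base.
    by rewrite -[7 * n]addn0; exact: M_base.
  by rewrite -[11 * n]addn0; exact: M_base.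
move=> m l r mo m25 lp l97 rl hM.
have hm : m \in NTable.test_exponents.
  have /allP ok : all (fun i => odd i ==> (i \in NTable.test_exponents)) (iota 1 25) by [].
  by apply: (implyP (ok m _)); rewrite ?mem_iota.
have hl : l \in NTable.test_primes.
  have /allP ok : all (fun i => prime i ==> (i \in NTable.test_primes)) (iota 5 93) by [].
  by apply: (implyP (ok l _)); rewrite ?mem_iota.
have hb : (m %% (l - 1), l, r) \in base_congruences.
  apply: NTable.only_base_congruencesP NTable.only_base_congruences_291 _ _ _ _ hm hl rl _ => //.
  by move=> n; apply/dvdn_eq_mod0.
have [r0 _] := andP rl; have [l5 _] := andP l97.
have hmb n : M (m %% (l - 1)) (l * n + r) = 0 %[mod l].
  exact/dvdn_eq_mod0/M_base.
have lift := fermat_liftP mo lp l5.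
(* The base congruences with residue 0 are excluded by [1 <= r]. *)
have [hmb3 hlr] : m %% (l - 1) \in [:: 1; 3; 7] /\ (l, r) \in [:: (5, 4); (7, 5); (11, 6)].
  move: hb; rewrite !inE => /or4P[| | |/or4P[| | |/orP[]]] /eqP[-> -> re];
  by move: r0; rewrite re.
split=> //; last by exists (m %% (l - 1)).
by move: hlr; rewrite !inE => /or3P[] /eqP[-> _].
Qed.
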